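(* For $a\in\mathbb C^*=\mathbb C\setminus\{0\}$ let $\tau_a$ be the translation operator on $H(\mathbb C)$ defined by $\tau_af(z)=f(z+a)$. Then the set $\bigcap_{a\in\mathbb C^*}FHC(\tau_a)$ is nonempty.
   Context: $H(\mathbb C)$ is the Fréchet space of entire functions with the topology of uniform convergence on compact sets. The lower density of $A\subset\mathbb N$ is $\underline{\mathrm{dens}}(A)=\liminf_{N\to+\infty}\frac{\#\{n\le N:\ n\in A\}}{N}$. For a continuous linear operator $T$ on a separable $F$-space $X$, $FHC(T)$ is the set of frequently hypercyclic vectors of $T$: those $x\in X$ such that for every nonempty open $U\subset X$ the set $\{n:\ T^nx\in U\}$ has positive lower density. *)

(* Defs.v *)
From HB Require Import structures.
From mathcomp Require Import all_boot all_order all_algebra.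
From mathcomp Require Import complex.
From mathcomp Require Import all_classical all_reals all_analysis.

Set Implicit Arguments.
Unset Strict Implicit.
Unset Printing Implicit Defensive.

Import Order.TTheory GRing.Theory Num.Theory.
Import numFieldNormedType.Exports.

Local Open Scope classical_set_scope.
Local Open Scope complex_scope.
Local Open Scope ring_scope.

(* The complex plane is R[i] with the topology of its modulus.  The library
   puts this structure on the alias R[i]^o; it is copied to R[i] itself. *)
#[warnings="-redundant-canonical-projection"]
HB.instance Definition _ (R : realType) := NormedModule.copy R[i] R[i]^o.

(* Since R[i] is a normed module over itself, the limit defining
   derivable f z 1 is taken over complex increments h -> 0. *)
Definition entire (R : realType) : set {family compact, R[i] -> R[i]} :=
  [set f | forall z : R[i], derivable f z 1].

(* H(C), with the topology induced by that of uniform convergence on compact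
   sets, carried by {family compact, _ -> _}. *)
Definition entire_space (R : realType) : uniformType := set_type (@entire R).

Lemma entire_shift (R : realType) (a : R[i]) (f : entire_space R) :
  entire (fun z => set_val f (z + a)).
Proof.
move=> z; rewrite /derivable.
have -> : (fun w => set_val f (w + a)) \o shift z = set_val f \o shift (z + a).
  by apply/funext => w; rewrite /= addrA.
exact: (set_valP f (z + a)).
Qed.

Definition translation (R : realType) (a : R[i]) (f : entire_space R) :
    entire_space R := exist (fun g => g \in @entire R) (fun z => set_val f (z + a))
    (mem_set (@entire_shift R a f)).

(* Whether 0 is counted, and the value of the quotient at N = 0, do not affect
   the limit inferior. *)
Definition lower_density (R : realType) (A : set nat) : R :=
  limn_inf (fun N : nat => #|[pred n : 'I_N.+1 | (n : nat) \in A]|%:R / N%:R).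

(* Only the topology of X and the iterates of T enter the definition. *)
Definition FHC (R : realType) (X : topologicalType) (T : X -> X) : set X :=
  [set x | forall U : set X, open U -> U !=set0 ->
    0 < lower_density R [set n | U (iter n T x)]].

(* Main.v *)
(* A dense sequence of polynomials [P_l] is copied around the plane. The plane is
   cut into square rings, the [j]-th one carrying, around all points of a square
   lattice that lie in it, copies of [P_l] with [l = v_2(j)]. For every [a] the
   multiples of [a] return close to the lattice with bounded gaps, by the
   pigeonhole principle on the torus, so those falling in rings of type [l] and
   near a lattice point have positive lower density. An entire function close to
   all these copies exists by Runge approximation: disjoint cells are glued across
   the lines of the grid that separate them. That the polynomials are dense among
   entire functions is Cauchy's formula, obtained from Goursat's bisection argument
   applied to finite midpoint sums, followed by pole pushing. *)
Require Import Defs.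
From HB Require Import structures.
From mathcomp Require Import all_boot all_order all_algebra.
From mathcomp Require Import complex.
From mathcomp Require Import all_classical all_reals all_analysis.
From mathcomp Require Import zify ring lra.
Import Order.TTheory GRing.Theory Num.Theory.
Import numFieldNormedType.Exports.
Local Open Scope classical_set_scope.
Local Open Scope complex_scope.
Local Open Scope ring_scope.
Import ComplexField.

Set Implicit Arguments.
Unset Strict Implicit.
Unset Printing Implicit Defensive.

(** The intersection runs over uncountably many [a], so one function has to serve every direction
    and every step length at once. What makes this possible is that the bound on the return gaps may
    depend on [a] and on the lattice: each type of ring keeps a fixed lattice, and positivity of a
    lower density is tested for one [a] at a time. The index [l] has two roles, selecting a
    polynomial and fixing the half side [2 ^ l] of its cells. An open set only tests a function on
    one square, so a hit requires both a good polynomial and a cell larger than that square; hence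
    every polynomial has to recur at arbitrarily large indices. On the analytic side, a function is
    only assumed complex differentiable at each point, with no continuity of the derivative, so
    Goursat's argument is unavoidable. All of Runge's theory is expressed through closure properties
    of [poly_approx]: sums, products, Neumann series and gluing. *)

Local Notation Re := (@complex.Re _).
Local Notation Im := (@complex.Im _).

(** * The modulus as a real number *)

Section ComplexModulus.
Context {R : realType}.
Implicit Types (x y z w : R[i]) (t : R).

Definition cabs z : R := Normc.normc z.

Lemma normr_cabs z : `|z| = (cabs z)%:C.
Proof. by []. Qed.

Lemma cabs_ge0 z : 0 <= cabs z.
Proof. by case: z => a b; exact: sqrtr_ge0. Qed.

Lemma cabs0 : cabs 0 = 0.
Proof. exact: Normc.normc0. Qed.

Lemma cabs1 : cabs 1 = 1.
Proof. exact: Normc.normc1. Qed.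

Lemma cabsM z w : cabs (z * w) = cabs z * cabs w.
Proof. exact: Normc.normcM. Qed.

Lemma cabsV z : cabs z^-1 = (cabs z)^-1.
Proof. exact: Normc.normcV. Qed.

Lemma cabsN z : cabs (- z) = cabs z.
Proof. exact: normcN. Qed.

Lemma cabsD z w : cabs (z + w) <= cabs z + cabs w.
Proof. exact: le_normcD. Qed.

Lemma cabsB z w : cabs (z - w) <= cabs z + cabs w.
Proof. by apply: le_trans (cabsD _ _) _; rewrite cabsN. Qed.

Lemma cabs_distC z w : cabs (z - w) = cabs (w - z).
Proof. by rewrite -cabsN opprB. Qed.

Lemma cabs_dist_trans y z w : cabs (z - w) <= cabs (z - y) + cabs (y - w).
Proof. by apply: le_trans (cabsD _ _); rewrite addrA subrK. Qed.

Lemma cabs_le_dist z w : cabs z <= cabs w + cabs (z - w).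
Proof. by apply: le_trans (cabsD _ _); rewrite addrC subrK. Qed.

Lemma cabsX z n : cabs (z ^+ n) = cabs z ^+ n.
Proof. by elim: n => [|n IHn]; rewrite ?expr0 ?cabs1// !exprS cabsM IHn. Qed.

Lemma cabs_eq0 z : (cabs z == 0) = (z == 0).
Proof.
apply/eqP/eqP => [|->]; last exact: cabs0.
exact: Normc.eq0_normc.
Qed.

Lemma cabs_gt0 z : (0 < cabs z) = (z != 0).
Proof. by rewrite lt_def cabs_eq0 cabs_ge0 andbT. Qed.

Lemma cabs_real t : cabs t%:C = `|t|.
Proof. by rewrite /cabs /= expr0n /= addr0 sqrtr_sqr. Qed.

Lemma cabs_sqr z : cabs z ^+ 2 = Re z ^+ 2 + Im z ^+ 2.
Proof. by case: z => a b; rewrite sqr_sqrtr// addr_ge0 ?sqr_ge0. Qed.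

Lemma Re_addc z w : Re (z + w) = Re z + Re w.
Proof. by case: z; case: w. Qed.
Lemma Im_addc z w : Im (z + w) = Im z + Im w.
Proof. by case: z; case: w. Qed.
Lemma Re_oppc z : Re (- z) = - Re z.
Proof. by case: z. Qed.
Lemma Im_oppc z : Im (- z) = - Im z.
Proof. by case: z. Qed.
Lemma Re_mulc z w : Re (z * w) = Re z * Re w - Im z * Im w.
Proof. by case: z; case: w. Qed.
Lemma Im_mulc z w : Im (z * w) = Re z * Im w + Im z * Re w.
Proof. by case: z => ? ?; case: w => ? ? /=; rewrite addrC. Qed.
Lemma Re_i : Re ('i : R[i]) = 0. Proof. by []. Qed.
Lemma Im_i : Im ('i : R[i]) = 1. Proof. by []. Qed.
Lemma Re_real t : Re (t%:C) = t. Proof. by []. Qed.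
Lemma Im_real t : Im (t%:C) = 0. Proof. by []. Qed.

Definition reim := (Re_addc, Im_addc, Re_oppc, Im_oppc, Re_mulc, Im_mulc, Re_i, Im_i, Re_real, Im_real).

Lemma complex_ext z w : Re z = Re w -> Im z = Im w -> z = w.
Proof. by case: z; case: w => /= ? ? ? ? -> ->. Qed.

Lemma Re_cabs z : `|Re z| <= cabs z.
Proof.
rewrite -(@ler_pXn2r _ 2) ?nnegrE ?cabs_ge0// cabs_sqr real_normK ?num_real//.
by rewrite lerDl sqr_ge0.
Qed.

Lemma Im_cabs z : `|Im z| <= cabs z.
Proof.
rewrite -(@ler_pXn2r _ 2) ?nnegrE ?cabs_ge0// cabs_sqr real_normK ?num_real//.
by rewrite lerDr sqr_ge0.
Qed.

Lemma cabs_i : cabs ('i : R[i]) = 1.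
Proof. by rewrite /cabs /= expr0n expr1n add0r sqrtr1. Qed.

Lemma cabs_ReIm z : cabs z <= `|Re z| + `|Im z|.
Proof.
rewrite [z in leLHS]complexE; apply: le_trans (cabsD _ _) _.
by rewrite cabsM cabs_i mul1r !cabs_real.
Qed.

Lemma cabs_le_sqr z t : 0 <= t -> (cabs z <= t) = (Re z ^+ 2 + Im z ^+ 2 <= t ^+ 2).
Proof. by move=> t0; rewrite -cabs_sqr ler_pXn2r ?nnegrE ?cabs_ge0. Qed.

Lemma cabs_sum (I : Type) (r : seq I) (P : pred I) (F : I -> R[i]) :
  cabs (\sum_(i <- r | P i) F i) <= \sum_(i <- r | P i) cabs (F i).
Proof.
apply: (big_ind2 (fun (a : R[i]) (b : R) => cabs a <= b)) => //.
  by rewrite cabs0.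
by move=> a s b t ha hb; apply: le_trans (cabsD _ _) (lerD ha hb).
Qed.

End ComplexModulus.

(** * Uniform approximation by polynomials and pole pushing *)

Section PolynomialApproximation.
Context {R : realType}.
Local Notation C := R[i].
Implicit Types (K : set C) (f g : C -> C) (p : {poly C}).

Definition poly_approx K g :=
  forall e : R, 0 < e -> exists p, forall z, K z -> cabs (g z - p.[z]) <= e.

Definition cbounded K := exists M : R, forall z, K z -> cabs z <= M.

Lemma poly_bounded K p : cbounded K ->
  exists2 M : R, 0 < M & forall z, K z -> cabs p.[z] <= M.
Proof.
move=> [B hB]; elim/poly_ind: p => [|p c [M M0 hM]].
  by exists 1 => // z _; rewrite horner0 cabs0.
exists (M * `|B| + cabs c + 1).
  by rewrite ltr_wpDl// addr_ge0 ?cabs_ge0 ?mulr_ge0// ltW.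
move=> z Kz; rewrite hornerMXaddC; apply: le_trans (cabsD _ _) _.
rewrite -addrA lerD//; last by rewrite lerDl.
rewrite cabsM ler_pM ?cabs_ge0 ?hM//.
by apply: le_trans (hB _ Kz) (ler_norm _).
Qed.

Lemma poly_approx_eq K f g : poly_approx K f -> (forall z, K z -> f z = g z) -> poly_approx K g.
Proof.
move=> hf fg e e0; have [p hp] := hf e e0; exists p => z Kz.
by rewrite -fg//; exact: hp.
Qed.

Lemma poly_approx_sub K K' f : K `<=` K' -> poly_approx K' f -> poly_approx K f.
Proof.
by move=> KK hf e e0; have [p hp] := hf e e0; exists p => z /KK; exact: hp.
Qed.

Lemma poly_approx_horner K p : poly_approx K (fun z => p.[z]).
Proof. by move=> e e0; exists p => z _; rewrite subrr cabs0 ltW. Qed.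

Lemma poly_approx_cst K c : poly_approx K (fun=> c).
Proof.
apply: (poly_approx_eq (@poly_approx_horner K c%:P)) => z _.
by rewrite hornerC.
Qed.

Lemma poly_approx_id K : poly_approx K id.
Proof.
apply: (poly_approx_eq (@poly_approx_horner K 'X)) => z _.
by rewrite hornerX.
Qed.

Lemma poly_approx_bounded K g : cbounded K -> poly_approx K g ->
  exists2 M : R, 0 < M & forall z, K z -> cabs (g z) <= M.
Proof.
move=> bK hg; have [p hp] := hg 1 ltr01.
have [M M0 hM] := poly_bounded p bK; exists (M + 1); first exact: addr_gt0.
move=> z Kz; apply: le_trans (cabs_le_dist _ p.[z]) _.
by apply: lerD; [exact: hM|exact: hp].
Qed.

Lemma poly_approxD K f g : poly_approx K f -> poly_approx K g ->
  poly_approx K (fun z => f z + g z).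
Proof.
move=> hf hg e e0; have e2 : 0 < e / 2 by rewrite divr_gt0.
have [p hp] := hf _ e2; have [q hq] := hg _ e2; exists (p + q) => z Kz.
rewrite hornerD opprD addrACA; apply: le_trans (cabsD _ _) _.
by rewrite (splitr e) lerD ?hp ?hq.
Qed.

Lemma poly_approxM K f g : cbounded K -> poly_approx K f -> poly_approx K g ->
  poly_approx K (fun z => f z * g z).
Proof.
move=> bK hf hg e e0; have [M M0 hM] := poly_approx_bounded bK hf.
have [q hq] := hg (e / (2 * M)) ltac:(by rewrite divr_gt0 ?mulr_gt0).
have [M' M'0 hM'] := poly_bounded q bK.
(* [p] is chosen last: its tolerance depends on the bound [M'] of [q]. *)
have [p hp] := hf (e / (2 * M')) ltac:(by rewrite divr_gt0 ?mulr_gt0).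
exists (p * q) => z Kz; rewrite hornerM.
have -> : f z * g z - p.[z] * q.[z] = f z * (g z - q.[z]) + (f z - p.[z]) * q.[z].
  by ring.
apply: le_trans (cabsD _ _) _; rewrite !cabsM.
have -> : e = M * (e / (2 * M)) + e / (2 * M') * M' by field; lra.
by apply: lerD; apply: ler_pM; rewrite ?cabs_ge0 ?hM ?hM' ?hp ?hq.
Qed.

Lemma poly_approxN K f : poly_approx K f -> poly_approx K (fun z => - f z).
Proof.
move=> hf e e0; have [p hp] := hf _ e0; exists (- p) => z Kz.
by rewrite hornerN -opprD cabsN hp.
Qed.

Lemma poly_approxB K f g : poly_approx K f -> poly_approx K g ->
  poly_approx K (fun z => f z - g z).
Proof. by move=> hf hg; apply: poly_approxD => //; exact: poly_approxN. Qed.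

Lemma poly_approxX K f n : cbounded K -> poly_approx K f ->
  poly_approx K (fun z => f z ^+ n).
Proof.
move=> bK hf; elim: n => [|n IHn].
  by apply: (poly_approx_eq (@poly_approx_cst K 1)) => z _; rewrite expr0.
by apply: (poly_approx_eq (poly_approxM bK hf IHn)) => z _; rewrite exprS.
Qed.

Lemma poly_approx_unif K g :
  (forall e : R, 0 < e -> exists2 f, poly_approx K f &
     forall z, K z -> cabs (g z - f z) <= e) -> poly_approx K g.
Proof.
move=> h e e0; have e2 : 0 < e / 2 by rewrite divr_gt0.
have [f hf fg] := h _ e2; have [p hp] := hf _ e2; exists p => z Kz.
apply: le_trans (cabs_dist_trans (f z) _ _) _.
by rewrite (splitr e) lerD ?hp ?fg.
Qed.

Lemma expr_small (t e : R) : 0 <= t < 1 -> 0 < e -> exists n, t ^+ n <= e.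
Proof.
move=> /andP[t0 t1] e0.
have : (fun n => t ^+ n : R) @ \oo --> (0 : R).
  by apply: cvg_expr; rewrite ger0_norm.
move=> /cvgrPdist_le/(_ e e0)[n _ /(_ n (leqnn _))/=].
by rewrite sub0r normrN ger0_norm ?exprn_ge0// => h; exists n.
Qed.

Lemma cabs_1B_ge (z : C) (t : R) : cabs z <= t -> 1 - t <= cabs (1 - z).
Proof.
move=> zt; have := cabs_le_dist 1 (1 - z); rewrite cabs1.
have -> : 1 - (1 - z) = z by ring.
lra.
Qed.

Lemma poly_approx_neumann K g (t : R) : cbounded K -> poly_approx K g ->
  t < 1 -> (forall z, K z -> cabs (g z) <= t) ->
  poly_approx K (fun z => (1 - g z)^-1).
Proof.
move=> bK hg t1 gt; apply: poly_approx_unif => e e0.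
(* A negative [t] forces [K] to be empty. *)
have [t0|t0] := ltP t 0.
  exists (fun=> 0); first exact: poly_approx_cst.
  by move=> z /gt h; have := le_lt_trans h t0; rewrite ltNge cabs_ge0.
have [n hn] : exists n, t ^+ n <= e * (1 - t).
  by apply: expr_small; [exact/andP|rewrite mulr_gt0 ?subr_gt0].
exists (fun z => \sum_(i < n) g z ^+ i).
  elim: n {hn} => [|n IHn].
    by apply: (poly_approx_eq (@poly_approx_cst K 0)) => z _; rewrite big_ord0.
  apply: (poly_approx_eq (poly_approxD IHn (poly_approxX n bK hg))) => z _.
  by rewrite big_ord_recr.
move=> z Kz; have h1 := cabs_1B_ge (gt _ Kz).
have g1 : 1 - g z != 0 by rewrite -cabs_gt0; lra.
have -> : (1 - g z)^-1 - \sum_(i < n) g z ^+ i = g z ^+ n / (1 - g z).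
  apply: (mulIf g1); rewrite mulrBl mulVf// mulfVK//.
  have -> : g z ^+ n = 1 + (g z - 1) * \sum_(i < n) g z ^+ i.
    by rewrite -subrX1; ring.
  by ring.
rewrite cabsM cabsV cabsX ler_pdivrMr; last lra.
apply: le_trans (_ : t ^+ n <= _).
  by rewrite lerXn2r ?nnegrE ?cabs_ge0// gt.
by apply: le_trans hn _; rewrite ler_pM2l.
Qed.

(* Pole pushing: moving a pole outwards by less than its distance to [K] is a
   geometric series in the old one. *)
Lemma pole_push K (w v : C) (d : R) : cbounded K -> 0 < d ->
  (forall z, K z -> d <= cabs (w - z)) -> cabs (w - v) <= d / 2 ->
  poly_approx K (fun z => (w - z)^-1) -> poly_approx K (fun z => (v - z)^-1).
Proof.
move=> bK d0 wK wv hw.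
have hg := poly_approxM bK (@poly_approx_cst K (w - v)) hw.
have := @poly_approx_neumann _ _ (1 / 2) bK hg.
move=> /(_ ltac:(lra)) hn.
have {}hn := hn _.
apply: (poly_approx_eq (poly_approxM bK hw (hn _))).
  move=> z Kz; rewrite cabsM cabsV ler_pdivrMr; last first.
    exact: lt_le_trans (wK _ Kz).
  by have := wK _ Kz; lra.
move=> z Kz /=.
have wz : w - z != 0 by rewrite -cabs_gt0; apply: lt_le_trans (wK _ Kz).
have -> : v - z = (w - z) * (1 - (w - v) / (w - z)) by field.
by rewrite invfM.
Qed.

(** A geometric series in [z / w]; this is where pole pushing starts. *)
Lemma pole_far K (w : C) (M : R) : (forall z, K z -> cabs z <= M) ->
  M < cabs w -> poly_approx K (fun z => (w - z)^-1).
Proof.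
move=> KM Mw; have bK : cbounded K by exists M.
have [->|/set0P[z0 Kz0]] := eqVneq K set0.
  by move=> e e0; exists 0.
have w0 : 0 < cabs w by apply: le_lt_trans Mw; apply: le_trans (KM _ Kz0); exact: cabs_ge0.
have w0' : w != 0 by rewrite -cabs_gt0.
have hn := @poly_approx_neumann _ _ (M / cabs w) bK
  (poly_approxM bK (@poly_approx_cst K w^-1) (@poly_approx_id K)).
apply: (poly_approx_eq (poly_approxM bK (@poly_approx_cst K w^-1) (hn _ _))).
- by rewrite ltr_pdivrMr// mul1r.
- move=> z Kz; rewrite cabsM cabsV mulrC ler_pM2r ?invr_gt0//; exact: KM.
- move=> z _ /=; have -> : w - z = w * (1 - w^-1 * z) by field.
  by rewrite invfM.
Qed.

(* The pole starts beyond a disc containing [K] and is pushed in along the ray. *)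
Lemma pole_ray K (w u : C) (d : R) : cbounded K -> 0 < d -> cabs u = 1 ->
  (forall (t : R) z, 0 <= t -> K z -> d <= cabs (w + t%:C * u - z)) ->
  poly_approx K (fun z => (w - z)^-1).
Proof.
move=> bK d0 u1 hd; have [M KM] := bK.
pose v n : C := w + (d / 2 * n%:R)%:C * u.
have [n hn] : exists n, poly_approx K (fun z => (v n - z)^-1).
  have [n hn] : exists n, `|M| + cabs w < d / 2 * n.+1%:R.
    exists (Num.truncn ((`|M| + cabs w) / (d / 2))).
    by rewrite mulrC -ltr_pdivrMr ?truncnS_gt//; lra.
  exists n.+1; apply: (pole_far KM).
  have vw : cabs (v n.+1 - w) = d / 2 * n.+1%:R.
    rewrite /v addrAC subrr add0r cabsM u1 mulr1 cabs_real ger0_norm//.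
    by rewrite mulr_ge0//; lra.
  have := cabsB (v n.+1) w; rewrite vw.
  by have := ler_norm M; lra.
elim: n hn => [|n IHn] hn.
  by apply: (poly_approx_eq hn) => z _; rewrite /v mulr0 mul0r addr0.
apply: IHn; apply: (pole_push bK d0 _ _ hn) => [z Kz|].
  by apply: hd => //; rewrite mulr_ge0//; lra.
have -> : v n.+1 - v n = (d / 2)%:C * u.
  rewrite /v (_ : d / 2 * n.+1%:R = d / 2 * n%:R + d / 2); last first.
    by rewrite -(natr1 n); ring.
  by rewrite rmorphD/=; ring.
by rewrite cabsM u1 mulr1 cabs_real ger0_norm//; lra.
Qed.

(** Over an algebraically closed field [p] splits, so simple poles are enough. *)
Lemma poly_approx_invp K p : cbounded K -> p != 0 ->
  (forall w, root p w -> poly_approx K (fun z => (w - z)^-1)) ->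
  poly_approx K (fun z => (p.[z])^-1).
Proof.
move=> bK p0 hw.
have [r pr] := closed_field_poly_normal p.
have lp : lead_coef p != 0 by rewrite lead_coef_eq0.
have {}hw w : w \in r -> poly_approx K (fun z => (w - z)^-1).
  move=> wr; apply: hw; rewrite pr rootZ// root_prod_XsubC//.
rewrite pr; elim: r {pr} hw => [|w r IHr] hw.
  apply: (poly_approx_eq (@poly_approx_cst K (lead_coef p)^-1)) => z _.
  by rewrite big_nil hornerZ hornerC mulr1.
have hr := IHr (fun x xr => hw x (mem_behead (s := w :: r) xr)).
apply: (poly_approx_eq (poly_approxM bK hr (poly_approxN (hw w (mem_head _ _))))).
move=> z _ /=; rewrite big_cons !hornerZ hornerM hornerXsubC !invfM.
by rewrite -(opprB w z) invrN; ring.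
Qed.

End PolynomialApproximation.

(** * Separation by a line and gluing of approximations *)

Section Gluing.
Context {R : realType}.
Local Notation C := R[i].
Implicit Types (K : set C) (f g : C -> C) (p : {poly C}).

Definition square (c : C) (r : R) : set C :=
  [set z | `|Re z - Re c| <= r /\ `|Im z - Im c| <= r].

Lemma square0E (r : R) z : square 0 r z <-> `|Re z| <= r /\ `|Im z| <= r.
Proof. by rewrite /square /= !subr0. Qed.

Lemma square0_bounded (r : R) K : K `<=` square 0 r -> cbounded K.
Proof.
move=> KX; exists (r + r) => z /KX/square0E[h1 h2].
by apply: le_trans (cabs_ReIm _) _; rewrite lerD.
Qed.

(** The circle of centre [g - rho] and radius [rho] touches the line of abscissa [g]. In the strip
    of height [Y] its right arc deviates from that line by at most [h], as [Y ^+ 2 <= rho * h], and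
    its left arc is beyond [- Y]. *)
Lemma circle_abscissa (Y g h rho u v : R) : 0 < h -> Y ^+ 2 <= rho * h ->
  h <= rho -> g + h + Y <= 2 * rho -> `|v| <= Y ->
  (u - (g - rho)) ^+ 2 + v ^+ 2 = rho ^+ 2 -> `|u - g| <= h \/ u <= - Y.
Proof.
move=> h0 hY hrho hg /ler_normlP[v1 v2] E.
have vY : v ^+ 2 <= Y ^+ 2 by nra.
have [s0|s0] := leP 0 (u - (g - rho)).
  left; apply/ler_normlP; split; last by nra.
  rewrite leNgt; apply/negP => H.
  have : (u - (g - rho)) ^+ 2 < (rho - h) ^+ 2 by nra.
  by nra.
right; rewrite leNgt; apply/negP => H.
have : (u - (g - rho)) ^+ 2 < (rho - h) ^+ 2 by nra.
by nra.
Qed.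

Lemma inv1B_expr_small (u : C) (t : R) n : 0 <= t -> t ^+ n <= 1 / 2 ->
  cabs u <= t -> cabs ((1 - u ^+ n)^-1 - 1) <= 2 * t ^+ n.
Proof.
move=> t0 t2 ut.
have un : cabs (u ^+ n) <= t ^+ n by rewrite cabsX lerXn2r ?nnegrE ?cabs_ge0.
have h1 := cabs_1B_ge un.
have g1 : 1 - u ^+ n != 0 by rewrite -cabs_gt0; lra.
have -> : (1 - u ^+ n)^-1 - 1 = u ^+ n / (1 - u ^+ n) by field.
rewrite cabsM cabsV ler_pdivrMr; last lra.
apply: le_trans un _.
have : 0 <= t ^+ n by rewrite exprn_ge0.
by nra.
Qed.

Lemma inv1B_expr_large (u : C) (t : R) n : 0 < t -> t ^+ n <= 1 / 2 ->
  t^-1 <= cabs u -> cabs (1 - u ^+ n)^-1 <= 2 * t ^+ n.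
Proof.
move=> t0 t2 ut.
have tn : 0 < t ^+ n by rewrite exprn_gt0.
have un : (t ^+ n)^-1 <= cabs (u ^+ n).
  by rewrite cabsX -exprVn lerXn2r ?nnegrE ?cabs_ge0 ?invr_ge0// ltW.
have h1 := cabs_le_dist (u ^+ n) 1.
rewrite cabs1 cabs_distC in h1.
have h2 : 2 <= (t ^+ n)^-1 by rewrite -(invrK 2) lef_pV2 ?posrE; lra.
have h3 : (2 * t ^+ n)^-1 <= cabs (1 - u ^+ n).
  by rewrite invfM; lra.
rewrite cabsV -[leRHS]invrK lef_pV2 ?posrE ?invr_gt0//; last by rewrite mulr_gt0.
by apply: lt_le_trans h3; rewrite invr_gt0 mulr_gt0.
Qed.

(* [1 / (1 - ((z - c) / rho) ^+ n)] is close to 1 inside the circle of centre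
   [c] and radius [rho] and close to 0 outside; a large circle is almost a
   vertical line on the square, and its poles are pushed off vertically. *)
Lemma separate_Re (X al be e : R) : 0 <= X -> al < be -> 0 < e ->
  exists p, forall z, square 0 X z ->
    (Re z <= al -> cabs (1 - p.[z]) <= e) /\ (be <= Re z -> cabs p.[z] <= e).
Proof.
move=> X0 ab e0.
pose K := [set z : C | square 0 X z /\ (Re z <= al \/ be <= Re z)].
have bK : cbounded K by apply: (@square0_bounded X) => z [].
(* Thus [al = g - 2 * h] and [be = g + 2 * h]: a circle staying within [h] of the line of abscissa
   [g] keeps a distance [h] from both parts of [K]. *)
have [g gE] : exists g : R, g = (al + be) / 2 by eexists.
have [h hE] : exists h : R, h = (be - al) / 4 by eexists.
have h0 : 0 < h by lra.
have [rho rhoE] : exists rho : R,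
    rho = (X + 1) ^+ 2 / h + `|g| + 3 * h + 2 * (X + 1) by eexists.
have [q [q0 qh rhoq]] : exists q : R, [/\ 0 <= q, q * h = (X + 1) ^+ 2 &
    rho = q + `|g| + 3 * h + 2 * (X + 1)].
  exists ((X + 1) ^+ 2 / h); split=> //.
    by rewrite divr_ge0 ?sqr_ge0// ltW.
  by field; lra.
have gn := ler_norm g; have gn' := ler_norm (- g); rewrite normrN in gn'.
have rho0 : 0 < rho by lra.
have rhoh : (X + 1) ^+ 2 <= rho * h by nra.
pose t := (rho - h) / rho.
have t0 : 0 < t by rewrite divr_gt0; lra.
have t1 : t < 1 by rewrite ltr_pdivrMr; lra.
(* The bound 1/2 keeps [1 - u ^+ n] away from 0; the bound [e / 4] makes the error [2 * t ^+ n] at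
   most [e / 2], leaving [e / 2] for the polynomial. *)
have [n n0 htn] : exists2 n, (0 < n)%N & t ^+ n <= Num.min (1 / 2) (e / 4).
  have m0 : 0 < Num.min (1 / 2) (e / 4) by rewrite lt_min; apply/andP; lra.
  have [n hn] := @expr_small _ t _ ltac:(by rewrite ltW) m0.
  exists n.+1 => //; apply: le_trans hn.
  by rewrite exprS ler_piMl ?exprn_ge0// ltW.
move: htn; rewrite le_min => /andP[tn2 tne].
pose c : C := (g - rho)%:C.
pose u z : C := (rho^-1)%:C * (z - c).
pose P : {poly C} := 1 - ((rho^-1)%:C *: ('X - c%:P)) ^+ n.
have PE z : P.[z] = 1 - u z ^+ n.
  by rewrite /P hornerD hornerN horner_exp hornerZ hornerXsubC hornerC.
have cu z : cabs (u z) = cabs (z - c) / rho.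
  by rewrite cabsM cabs_real ger0_norm ?invr_ge0 1?ltW// mulrC.
have Rec z : Re (z - c) = Re z - (g - rho) by rewrite !reim.
have Imc z : Im (z - c) = Im z by rewrite !reim oppr0 addr0.
have P0 : P != 0.
  apply/eqP => /(congr1 (fun q => q.[c])); rewrite PE horner0 /u subrr mulr0.
  by rewrite expr0n gtn_eqF// subr0 => /eqP; rewrite oner_eq0.
have hP : poly_approx K (fun z => (P.[z])^-1).
  apply: (poly_approx_invp bK P0) => w /rootP.
  rewrite PE => /eqP; rewrite subr_eq0 eq_sym => /eqP uw.
  have wrho : cabs (w - c) = rho.
    have := congr1 cabs uw; rewrite cabsX cabs1 => /eqP.
    by rewrite pexpr_eq1 ?cabs_ge0// cu => /eqP /divr1_eq.
  have cw : (Re w - (g - rho)) ^+ 2 + Im w ^+ 2 = rho ^+ 2.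
    by rewrite -Rec -[in Im w](Imc w) -cabs_sqr wrho.
  pose d := Num.min h 1.
  have d0 : 0 < d by rewrite lt_min h0 ltr01.
  have dh : d <= h by rewrite ge_min lexx.
  have d1 : d <= 1 by rewrite ge_min lexx orbT.
  clearbody d.
  (* A pole in the upper half plane leaves upwards, the others downwards. If its height is at most
     [X + 1], its abscissa alone keeps the ray away from [K]; otherwise it starts at least 1 above
     or below the square. *)
  pose s : C := if 0 <= Im w then 'i else - 'i.
  have s1 : cabs s = 1 by rewrite /s; case: ifP; rewrite ?cabsN cabs_i.
  have sRe : Re s = 0 by rewrite /s; case: ifP; rewrite ?reim ?oppr0.
  apply: (pole_ray bK d0 s1) => a z a0 [/square0E[zX1 zX2] zab].
  have ReE : Re (w + a%:C * s - z) = Re w - Re z by rewrite !reim sRe; ring.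
  have ImE : Im (w + a%:C * s - z) = Im w + a * Im s - Im z.
    by rewrite !reim sRe; ring.
  move/ler_normlP: zX1 => [zX1 zX1']; move/ler_normlP: zX2 => [zX2 zX2'].
  have [vX|vX] := leP `|Im w| (X + 1).
    apply: le_trans (Re_cabs _); rewrite ReE.
    have hrho : h <= rho by lra.
    have grho : g + h + (X + 1) <= 2 * rho by lra.
    have [/ler_normlP[w1 w2]|w1] := circle_abscissa h0 rhoh hrho grho vX cw.
      by case: zab => ?; rewrite ler_normr; apply/orP; [left|right]; lra.
    by rewrite ler_normr; apply/orP; right; lra.
  apply: le_trans (Im_cabs _); rewrite ImE /s.
  move: vX; case: ifPn => [w0|]; rewrite ?reim.
    by rewrite ger0_norm// => vX; rewrite ler_normr; apply/orP; left; lra.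
  rewrite -ltNge => w0; rewrite ltr0_norm// => vX.
  by rewrite ler_normr; apply/orP; right; lra.
have e2 : 0 < e / 2 by lra.
have [p hp] := hP _ e2; exists p => z zX; split => hz.
  have Kz : K z by split=> //; left.
  have uz : cabs (u z) <= t.
    rewrite cu ler_pM2r ?invr_gt0// cabs_le_sqr; last lra.
    rewrite Rec Imc.
    move/square0E: zX => [/ler_normlP[zX1 zX1'] /ler_normlP[zX2 zX2']].
    have : (Re z - (g - rho)) ^+ 2 <= (rho - 2 * h) ^+ 2 by nra.
    have : Im z ^+ 2 <= (X + 1) ^+ 2 by nra.
    by nra.
  have := hp _ Kz; rewrite PE => hpz.
  have := inv1B_expr_small (ltW t0) tn2 uz; rewrite cabs_distC => h1.
  by apply: le_trans (cabs_dist_trans (1 - u z ^+ n)^-1 _ _) _; lra.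
have Kz : K z by split=> //; right.
have uz : t^-1 <= cabs (u z).
  rewrite cu /t invf_div ler_pdivlMr// mulrAC ler_pdivrMr; last lra.
  have := Re_cabs (z - c); rewrite Rec => /ler_normlP[_ hh].
  have : rho * rho <= (rho + 2 * h) * (rho - h) by nra.
  by nra.
have := hp _ Kz; rewrite PE => hpz.
have := inv1B_expr_large t0 tn2 uz => h1.
rewrite -[p.[z]]subr0; apply: le_trans (cabs_dist_trans (1 - u z ^+ n)^-1 _ _) _.
by rewrite subr0 cabs_distC; lra.
Qed.

(** With [p] good on the left, [q] on the right and [h] close to 1 on the left and to 0 on the
    right, [q - h * (q - p)] is good on both sides. The tolerance for [h] is divided by a bound of
    [q - p]. *)
Lemma glue_Re K g (X al be : R) : K `<=` square 0 X -> al < be ->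
  (forall z, K z -> Re z <= al \/ be <= Re z) ->
  poly_approx [set z | K z /\ Re z <= al] g ->
  poly_approx [set z | K z /\ be <= Re z] g -> poly_approx K g.
Proof.
move=> KX ab Kab hl hr e e0.
have [X0|X0] := ltP X 0.
  exists 0 => z /KX/square0E[/(le_trans (normr_ge0 _))].
  by rewrite leNgt X0.
have bK : cbounded K by exact: square0_bounded KX.
have e2 : 0 < e / 2 by lra.
have [p hp] := hl _ e2; have [q hq] := hr _ e2.
have [M M0 hM] := poly_bounded (q - p) bK.
have [h hh] := @separate_Re X al be (e / (2 * M)) X0 ab ltac:(by rewrite divr_gt0// mulr_gt0).
have eM : e / 2 = e / (2 * M) * M by field; lra.
exists (q - h * (q - p)) => z Kz; have := hM _ Kz.
rewrite !hornerE => hMz.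
have [hz1 hz2] := hh _ (KX _ Kz).
have [zab|zab] := Kab _ Kz.
  rewrite (_ : _ - _ = g z - p.[z] - (1 - h.[z]) * (q.[z] - p.[z])); last by ring.
  apply: le_trans (cabsB _ _) _; rewrite cabsM [leRHS]splitr {2}eM lerD ?hp//.
  by rewrite ler_pM ?cabs_ge0 ?hz1.
rewrite (_ : _ - _ = g z - q.[z] + h.[z] * (q.[z] - p.[z])); last by ring.
apply: le_trans (cabsD _ _) _; rewrite cabsM [leRHS]splitr {2}eM lerD ?hq//.
by rewrite ler_pM ?cabs_ge0 ?hz2.
Qed.

(** Rotation by ['i] preserves polynomials and turns cuts along vertical lines into cuts along
    horizontal ones. *)
Lemma poly_approx_rot K g : poly_approx K g <->
  poly_approx [set z | K ('i * z)] (fun z => g ('i * z)).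
Proof.
split=> H e e0; have [p hp] := H e e0.
  exists (p \Po ('i *: 'X)) => z Kz.
  by rewrite horner_comp hornerZ hornerX; exact: hp.
exists (p \Po (- 'i *: 'X)) => z Kz.
have iz : 'i * (- 'i * z) = z :> C.
  by apply: complex_ext; rewrite !reim; ring.
by rewrite horner_comp hornerZ hornerX -{1}iz; apply: hp; rewrite /= iz.
Qed.

Lemma glue_Im K g (X al be : R) : K `<=` square 0 X -> al < be ->
  (forall z, K z -> Im z <= al \/ be <= Im z) ->
  poly_approx [set z | K z /\ Im z <= al] g ->
  poly_approx [set z | K z /\ be <= Im z] g -> poly_approx K g.
Proof.
move=> KX ab Kab hl hr; apply/poly_approx_rot.
have ImE (z : C) : Im ('i * z) = Re z by rewrite !reim; ring.
apply: (@glue_Re _ _ X al be) => //.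
- move=> z /= /KX/square0E; rewrite !reim mul0r mul1r sub0r normrN mul0r add0r mul1r.
  by move=> [? ?]; apply/square0E.
- by move=> z /= /Kab; rewrite ImE.
- move/poly_approx_rot: hl; apply: poly_approx_sub => z /=.
  by rewrite ImE.
- move/poly_approx_rot: hr; apply: poly_approx_sub => z /=.
  by rewrite ImE.
Qed.

End Gluing.

(** * Bisection of squares *)

Section Bisection.
Context {R : realType}.
Local Notation C := R[i].

Lemma nested_intervals (u s : nat -> R) : (forall n, 0 <= s n) ->
  (forall n, u n <= u n.+1) -> (forall n, u n.+1 + s n.+1 <= u n + s n) ->
  exists x, forall n, u n <= x <= u n + s n.
Proof.
move=> s0 u1 us.
have um m n : u n <= u (n + m)%N.
  by elim: m => [|m IHm]; rewrite ?addn0// addnS; apply: le_trans IHm _.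
have usm m n : u (n + m)%N + s (n + m)%N <= u n + s n.
  by elim: m => [|m IHm]; rewrite ?addn0// addnS; apply: le_trans (us _) _.
have ub n m : u m <= u n + s n.
  have [mn|nm] := leqP m n.
    apply: le_trans (um (n - m)%N m) _.
    by rewrite subnKC// lerDl.
  apply: le_trans (usm (m - n)%N n).
  by rewrite subnKC 1?ltnW// lerDl.
exists (sup (range u)) => n; apply/andP; split.
  apply: ub_le_sup; last by exists n.
  by exists (u n + s n) => _ [m _ <-].
by apply: ge_sup; [exists (u 0%N); exists 0%N|move=> _ [m _ <-]].
Qed.

(** Located by its lower left corner, unlike [square], because bisection moves corners. *)
Definition box (a : C) (s : R) : set C :=
  [set z | (Re a <= Re z <= Re a + s) /\ (Im a <= Im z <= Im a + s)].

Definition quarter (a : C) (h : R) : seq C :=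
  [:: a; a + h%:C; a + 'i * h%:C; a + h%:C + 'i * h%:C].

Lemma quarterP a h b : b \in quarter a h ->
  (Re b = Re a \/ Re b = Re a + h) /\ (Im b = Im a \/ Im b = Im a + h).
Proof.
rewrite !inE => /or4P[] /eqP ->; rewrite ?reim; split; lra.
Qed.

Lemma halving_small (s d : R) : 0 < d -> exists n, s / 2 ^+ n < d.
Proof.
move=> d0; have [|s0] := leP s 0.
  by exists 0%N; rewrite expr0 divr1; lra.
have [n hn] := @expr_small _ (1 / 2) (d / (2 * s)) ltac:(lra) ltac:(by rewrite divr_gt0// mulr_gt0).
exists n; apply: le_lt_trans (_ : d / 2 < d); last by lra.
rewrite (_ : s / 2 ^+ n = s * (1 / 2) ^+ n); last by rewrite div1r exprVn.
rewrite (_ : d / 2 = s * (d / (2 * s))); first by rewrite ler_pM2l.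
by field; lra.
Qed.

(* Replaces compactness of squares: a property of squares that passes from the
   four quarters to the whole holds everywhere once it holds locally. *)
Lemma bisection_ind (P : C -> R -> Prop) a0 s0 :
  (forall a s, 0 < s -> {in quarter a (s / 2), forall b, P b (s / 2)} -> P a s) ->
  0 < s0 ->
  (forall z, box a0 s0 z -> exists2 d : R, 0 < d &
     forall a s, 0 < s < d -> box a s z -> P a s) ->
  P a0 s0.
Proof.
move=> Pstep s00 Ploc; apply: contrapT => nP.
(* The conditions are placed after the existential so that choice yields a total map. *)
have next (as_ : C * R) : exists b, 0 < as_.2 -> ~ P as_.1 as_.2 ->
    b \in quarter as_.1 (as_.2 / 2) /\ ~ P b (as_.2 / 2).
  case: as_ => a s /=; have [s1|s1] := pselect (0 < s /\ ~ P a s); last first.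
    by exists 0 => ? ?; case: s1.
  have [[b bq nPb]|H] := pselect (exists2 b, b \in quarter a (s / 2) & ~ P b (s / 2)).
    by exists b.
  exfalso; case: s1 => s1; apply; apply: Pstep => // b bq.
  by apply: contrapT => nPb; apply: H; exists b.
have [F hF] := choice next.
pose s n := s0 / 2 ^+ n.
have sS n : s n.+1 = s n / 2 by rewrite /s exprS invfM mulrCA mulrC.
have sp n : 0 < s n by rewrite divr_gt0// exprn_gt0.
pose a := fix a n := if n is m.+1 then F (a m, s m) else a0.
have nPa n : ~ P (a n) (s n).
  elim: n => [|n IHn]; first by rewrite /s expr0 divr1.
  by rewrite sS; case: (hF (a n, s n) (sp n) IHn).
have aq n : a n.+1 \in quarter (a n) (s n / 2).
  by case: (hF (a n, s n) (sp n) (nPa n)).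
have [x hx] : exists x, forall n, Re (a n) <= x <= Re (a n) + s n.
  apply: (@nested_intervals (fun n => Re (a n)) s) => n; first exact: ltW.
  - by case: (quarterP (aq n)) => -[] -> _; have := sp n; lra.
  - by rewrite sS; case: (quarterP (aq n)) => -[] -> _; have := sp n; lra.
have [y hy] : exists y, forall n, Im (a n) <= y <= Im (a n) + s n.
  apply: (@nested_intervals (fun n => Im (a n)) s) => n; first exact: ltW.
  - by case: (quarterP (aq n)) => _ [] ->; have := sp n; lra.
  - by rewrite sS; case: (quarterP (aq n)) => _ [] ->; have := sp n; lra.
have zb n : box (a n) (s n) (x +i* y) by split; [exact: hx|exact: hy].
have [|d d0 hd] := Ploc (x +i* y).
  by have := zb 0%N; rewrite /s expr0 divr1.
have [n hn] := halving_small s0 d0.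
by apply: (nPa n); apply: hd (zb n); rewrite sp.
Qed.

End Bisection.

(** * Midpoint sums along segments and squares *)

Section ContourSums.
Context {R : realType}.
Local Notation C := R[i].
Implicit Types (f g : C -> C) (a d : C) (s : R).

(* Midpoint sums with [2 ^ n] nodes stand in for line integrals: they are exact
   on affine functions and exactly additive under bisection. *)
Fixpoint seg_sum f n a d : C :=
  if n is m.+1 then seg_sum f m a (d / 2) + seg_sum f m (a + d / 2) (d / 2)
  else d * f (a + d / 2).

Definition on_seg a d (P : C -> Prop) :=
  forall t : R, 0 <= t <= 1 -> P (a + t%:C * d).

Lemma half_real (t : R) : (t / 2)%:C = t%:C / 2 :> C.
Proof. by rewrite rmorphM/= fmorphV rmorph_nat. Qed.

Lemma on_seg_left a d P : on_seg a d P -> on_seg a (d / 2) P.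
Proof.
move=> H t t1; rewrite (_ : t%:C * (d / 2) = (t / 2)%:C * d).
  by apply: H; lra.
by rewrite half_real; ring.
Qed.

Lemma on_seg_right a d P : on_seg a d P -> on_seg (a + d / 2) (d / 2) P.
Proof.
move=> H t t1.
rewrite (_ : _ + _ = a + (1 / 2 + t / 2)%:C * d); first by apply: H; lra.
rewrite rmorphD/= !half_real rmorph1; ring.
Qed.

Lemma on_seg_mid a d P : on_seg a d P -> P (a + d / 2).
Proof.
move=> /(_ (1 / 2) ltac:(lra)); rewrite half_real rmorph1.
by rewrite mul1r mulrC.
Qed.

Lemma seg_sum_le f n a d (M : R) :
  on_seg a d (fun w => cabs (f w) <= M) -> cabs (seg_sum f n a d) <= cabs d * M.
Proof.
elim: n a d => [|n IHn] a d H /=.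
  by rewrite cabsM ler_wpM2l ?cabs_ge0//; exact: on_seg_mid H.
have c2 : cabs (d / 2) = cabs d / 2.
  by rewrite -[2 in LHS](rmorph_nat (@real_complex_def R (Phant R))) cabsM cabsV cabs_real ger0_norm.
apply: le_trans (cabsD _ _) _.
have := IHn _ _ (on_seg_left H); have := IHn _ _ (on_seg_right H).
by rewrite c2; lra.
Qed.

(** Meant for the imaginary part and its opposite. Additivity of [L] already gives compatibility
    with halving, which is all that bisection uses. *)
Lemma seg_sum_ge (L : C -> R) f n a d (k : R) :
  (forall x y, L (x + y) = L x + L y) ->
  on_seg a d (fun w => k <= L (d * f w)) -> k <= L (seg_sum f n a d).
Proof.
move=> LD; elim: n a d k => [|n IHn] a d k H /=; first exact: on_seg_mid H.
have L2 x : L x = L (x / 2) + L (x / 2) by rewrite -LD -splitr.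
have Lh w : k <= L (d * f w) -> k / 2 <= L (d / 2 * f w).
  by rewrite L2 (_ : d / 2 * f w = d * f w / 2); [lra|ring].
rewrite LD (splitr k); apply: lerD; apply: IHn => t t1; apply: Lh.
  exact: (on_seg_left H).
exact: (on_seg_right H).
Qed.

Lemma seg_sum_affine (al be : C) n a d :
  seg_sum (fun w => al * w + be) n a d = d * (al * (a + d / 2) + be).
Proof.
elim: n a d => [|n IHn] a d //=; rewrite !IHn.
by field.
Qed.

Lemma seg_sumB f g (c : C) n a d :
  seg_sum (fun w => f w - c * g w) n a d = seg_sum f n a d - c * seg_sum g n a d.
Proof.
by elim: n a d => [|n IHn] a d /=; rewrite ?IHn; ring.
Qed.

Lemma seg_sum_approx K (F : C -> C -> C) n a d : cbounded K ->
  on_seg a d (fun w => poly_approx K (F w)) ->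
  poly_approx K (fun z => seg_sum (F^~ z) n a d).
Proof.
move=> bK; elim: n a d => [|n IHn] a d H /=.
  by apply: poly_approxM => //; [exact: poly_approx_cst|exact: on_seg_mid H].
apply: poly_approxD; apply: IHn; [exact: on_seg_left H|exact: on_seg_right H].
Qed.

(** The boundary taken counterclockwise: top and left sides are parametrised forwards and
    subtracted. *)
Definition contour f n a s : C :=
  seg_sum f n a s%:C + seg_sum f n (a + s%:C) ('i * s%:C)
  - seg_sum f n (a + 'i * s%:C) s%:C - seg_sum f n a ('i * s%:C).

Definition on_contour a s (P : C -> Prop) :=
  [/\ on_seg a s%:C P, on_seg (a + s%:C) ('i * s%:C) P,
      on_seg (a + 'i * s%:C) s%:C P & on_seg a ('i * s%:C) P].

Lemma on_contourP a s P : (forall w, box a s w ->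
    [\/ Re w = Re a, Re w = Re a + s, Im w = Im a | Im w = Im a + s] -> P w) ->
  0 <= s -> on_contour a s P.
Proof.
move=> H s0; split=> t /andP[t0 t1]; apply: H.
all: rewrite /box /= !reim; first [split; apply/andP; split; nra|idtac].
- by apply: Or43; ring.
- by apply: Or42; ring.
- by apply: Or44; ring.
- by apply: Or41; ring.
Qed.

(** Inner sides of the quarters cancel in pairs, and halving an outer side peels off one level of
    [seg_sum]; hence the depths [n.+1] and [n]. *)
Lemma contour_split f n a s : contour f n.+1 a s =
  \sum_(b <- quarter a (s / 2)) contour f n b (s / 2).
Proof.
rewrite /quarter !big_cons big_nil /contour /=.
set h := (s / 2)%:C.
have sh : s%:C = h + h by rewrite -rmorphD/= -splitr.
rewrite !sh.
have -> : (h + h) / 2 = h by field.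
have -> : 'i * (h + h) / 2 = 'i * h by field.
have -> : a + (h + h) = a + h + h by ring.
have -> : a + 'i * (h + h) = a + 'i * h + 'i * h by ring.
have -> : a + 'i * h + h = a + h + 'i * h by ring.
have -> : a + 'i * h + 'i * h + h = a + h + 'i * h + 'i * h by ring.
have -> : a + h + 'i * h + h = a + h + h + 'i * h by ring.
ring.
Qed.

Lemma contourB f g (c : C) n a s :
  contour (fun w => f w - c * g w) n a s = contour f n a s - c * contour g n a s.
Proof. by rewrite /contour !seg_sumB; ring. Qed.

Lemma contour_affine (al be : C) n a s :
  contour (fun w => al * w + be) n a s = 0.
Proof. by rewrite /contour !seg_sum_affine; field. Qed.

Lemma contour_le f n a s (M : R) : 0 <= s ->
  on_contour a s (fun w => cabs (f w) <= M) -> cabs (contour f n a s) <= 4 * s * M.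
Proof.
move=> s0 [h1 h2 h3 h4]; rewrite /contour.
have cs : cabs (s%:C) = s by rewrite cabs_real ger0_norm.
have cis : cabs ('i * s%:C) = s by rewrite cabsM cabs_i mul1r.
have := seg_sum_le n h1; have := seg_sum_le n h2; have := seg_sum_le n h3.
have := seg_sum_le n h4; rewrite cs cis => b4 b3 b2 b1.
apply: le_trans (cabsB _ _) _.
apply: le_trans (lerD (cabsB _ _) (lexx _)) _.
apply: le_trans (lerD (lerD (cabsD _ _) (lexx _)) (lexx _)) _.
lra.
Qed.

Lemma contour_approx K (F : C -> C -> C) n a s : cbounded K ->
  on_contour a s (fun w => poly_approx K (F w)) ->
  poly_approx K (fun z => contour (F^~ z) n a s).
Proof.
move=> bK [h1 h2 h3 h4]; rewrite /contour.
by apply: poly_approxB; [apply: poly_approxB; [apply: poly_approxD|]|];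
  exact: seg_sum_approx.
Qed.

End ContourSums.

(** * Goursat's lemma, also with an exceptional point *)

Section Goursat.
Context {R : realType}.
Local Notation C := R[i].
Implicit Types (f g : C -> C) (a d z : C) (s : R).

(** Differentiability with real tolerances and radii, related to [derivable] by [cdiffP]. *)
Definition cdiff f z := exists D : C, forall e : R, 0 < e ->
  exists2 r : R, 0 < r & forall w, cabs (w - z) <= r ->
    cabs (f w - f z - (w - z) * D) <= e * cabs (w - z).

Lemma box_dist a s z w : box a s z -> box a s w -> cabs (w - z) <= 2 * s.
Proof.
move=> [/andP[? ?] /andP[? ?]] [/andP[? ?] /andP[? ?]].
apply: le_trans (cabs_ReIm _) _; rewrite !reim.
have : `|Re w - Re z| <= s by apply/ler_normlP; split; lra.
have : `|Im w - Im z| <= s by apply/ler_normlP; split; lra.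
lra.
Qed.

Lemma quarter_sub a s b z : 0 < s -> b \in quarter a (s / 2) ->
  box b (s / 2) z -> box a s z.
Proof.
move=> s0 /quarterP[hr hi] [/andP[? ?] /andP[? ?]].
by split; apply/andP; split; case: hr => hr; case: hi => hi; lra.
Qed.

Lemma on_contour_box a s (P : C -> Prop) : 0 < s ->
  (forall w, box a s w -> P w) -> on_contour a s P.
Proof. by move=> s0 H; apply: on_contourP => [w /H//|]; exact: ltW. Qed.

Lemma contour_split_le f a s (B : C -> R) :
  (forall b, b \in quarter a (s / 2) ->
     exists N, forall n, (N <= n)%N -> cabs (contour f n b (s / 2)) <= B b) ->
  exists N, forall n, (N <= n)%N ->
    cabs (contour f n a s) <= \sum_(b <- quarter a (s / 2)) B b.
Proof.
move=> H.
have [N hN] : exists N, forall b, b \in quarter a (s / 2) ->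
    forall n, (N <= n)%N -> cabs (contour f n b (s / 2)) <= B b.
  elim: (quarter a (s / 2)) H => [|b q IHq] H; first by exists 0%N.
  have [N1 h1] := H b (mem_head _ _).
  have [|N2 h2] := IHq; first by move=> x xq; apply: H; rewrite inE xq orbT.
  exists (maxn N1 N2) => x; rewrite inE => /orP[/eqP ->|xq] n; rewrite geq_max => /andP[n1 n2].
    exact: h1.
  exact: h2.
(* One more level, because splitting the contour consumes one. *)
exists N.+1 => -[|n]// Nn; rewrite contour_split.
apply: le_trans (cabs_sum _ _ _) _.
by rewrite big_seq [leRHS]big_seq; apply: ler_sum => b bq; exact: hN.
Qed.

(** The bound is proportional to [s ^+ 2] because areas add up exactly under quartering. Locally it
    holds at every depth, since affine functions have contour sum 0 at every depth. *)
Lemma goursat f a s : 0 < s -> (forall z, box a s z -> cdiff f z) ->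
  forall e : R, 0 < e -> exists N, forall n, (N <= n)%N -> cabs (contour f n a s) <= e.
Proof.
move=> s0 df e e0.
have s2 : 0 < s ^+ 2 by rewrite exprn_gt0.
suff H (d : R) : 0 < d -> exists N, forall n, (N <= n)%N -> cabs (contour f n a s) <= d * s ^+ 2.
  have [|N hN] := H (e / s ^+ 2); first by rewrite divr_gt0.
  by exists N => n /hN; rewrite divfK// gt_eqF.
move: d {e e0} => e e0.
pose P a s := exists N, forall n, (N <= n)%N -> cabs (contour f n a s) <= e * s ^+ 2.
apply: (bisection_ind (P := P)) s0 _ => [b t t0 Pq|z /df[D hD]].
  have [N hN] := contour_split_le Pq; exists N => n /hN h.
  by apply: le_trans h _; rewrite !big_cons big_nil; lra.
(* Here 8 is 4 from the perimeter [4 * t] times 2 from the diameter bound [2 * t]. *)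
have [|r r0 hr] := hD (e / 8); first by lra.
exists (r / 2); first by lra.
move=> b t /andP[t0 tr] bz; exists 0%N => n _.
have -> : contour f n b t = contour (fun w => f w - 1 * (D * w + (f z - z * D))) n b t.
  by rewrite contourB contour_affine mulr0 subr0.
have -> : e * t ^+ 2 = 4 * t * (e / 8 * (2 * t)) by field.
apply: contour_le; first exact: ltW.
apply: on_contour_box => // w bw.
have wz := box_dist bz bw.
rewrite (_ : _ - _ = f w - f z - (w - z) * D); last by ring.
apply: le_trans (hr _ _) _; first lra.
by rewrite ler_wpM2l//; lra.
Qed.

(* [x] is on no line of the iterated bisection of [[a, a + s]], so at each step
   a point with generic coordinates lies in only one quarter. *)
Definition generic (x a s : R) :=
  forall (m : nat) (N : int), (x - a) * 2 ^+ m <> N%:~R * s.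

Lemma generic_half (x a b s : R) : generic x a s -> b = a \/ b = a + s / 2 ->
  generic x b (s / 2).
Proof.
move=> gx [] -> m N E.
  by apply: (gx m.+1 N); rewrite exprS; lra.
apply: (gx m.+1 (N + 2 ^+ m)); rewrite exprS rmorphD rmorphXn/=.
have -> : (x - a) * (2 * 2 ^+ m) = 2 * ((x - (a + s / 2)) * 2 ^+ m) + s * 2 ^+ m by field.
by rewrite E (_ : (2 : int)%:~R = 2 :> R)//; field.
Qed.

Lemma generic_mid (x a s : R) : generic x a s -> x <> a + s / 2.
Proof. by move=> gx E; apply: (gx 1%N 1); rewrite expr1 E; field. Qed.

(** The point one third of the way along a dyadic subinterval is generic: lying on a bisection line
    would make 3 divide [(3 * p + 1) * 2 ^+ m]. *)
Lemma generic_near (x a s e : R) : 0 < s -> 0 < e ->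
  exists2 y, `|y - x| <= e & generic y a s.
Proof.
move=> s0 e0; have [r hr] := halving_small s e0.
have s0' : s != 0 by rewrite gt_eqF.
have r0 : 0 < 2 ^+ r :> R by rewrite exprn_gt0.
have r0' : 2 ^+ r != 0 :> R by rewrite gt_eqF.
pose p := Num.floor ((x - a) / (s / 2 ^+ r)).
have sr0 : 0 < s / 2 ^+ r by rewrite divr_gt0.
exists (a + s / 2 ^+ r * (p%:~R + 1 / 3)).
  have xE : x = a + s / 2 ^+ r * ((x - a) / (s / 2 ^+ r)) by field; rewrite s0' r0'.
  have hp1 : p%:~R <= (x - a) / (s / 2 ^+ r) by exact: floor_le_tmp.
  have hp2 : (x - a) / (s / 2 ^+ r) < p%:~R + 1 by rewrite -intrD1; exact: floorD1_gt.
  rewrite [X in _ - X]xE.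
  move: ((x - a) / (s / 2 ^+ r)) hp1 hp2 => y hp1 hp2.
  by apply/ler_normlP; split; nra.
move=> m N E.
have {}E : (3 * p + 1) * 2 ^+ m = 3 * (N * 2 ^+ r).
  apply/eqP; rewrite -(eqr_int R) !rmorphM rmorphD !rmorphXn/= rmorphM/=.
  rewrite (_ : (2 : int)%:~R = 2 :> R)// (_ : (3 : int)%:~R = 3 :> R)//.
  apply/eqP; apply: (mulIf s0').
  have -> : 3 * (N%:~R * 2 ^+ r) * s = 3 * 2 ^+ r * (N%:~R * s) by ring.
  by rewrite -E rmorph1; field.
have : (3 %| (3 * p + 1) * 2 ^+ m)%Z by rewrite E dvdz_mulr.
rewrite Gauss_dvdzl; last by rewrite coprimezXr.
by rewrite rpredDl ?dvdz_mulr.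
Qed.

(* A point where [f] is merely bounded is confined to one quarter at each step,
   and the contour sum of that quarter is at most proportional to its side. *)
Lemma goursat_except f z a s (M : R) : 0 < s -> 0 <= M ->
  generic (Re z) (Re a) s -> generic (Im z) (Im a) s ->
  (forall w, box a s w -> w != z -> cdiff f w) ->
  (forall w, box a s w -> cabs (f w) <= M) ->
  forall e : R, 0 < e -> exists N, forall n, (N <= n)%N -> cabs (contour f n a s) <= e.
Proof.
move=> s0 M0 gx gy df fM e e0.
suff H m : exists N, forall n, (N <= n)%N ->
    cabs (contour f n a s) <= 4 * s * M / 2 ^+ m + e / 2.
  have [m hm] := @halving_small _ (4 * s * M) (e / 2) ltac:(lra).
  by have [N hN] := H m; exists N => n /hN; lra.
elim: m a s e s0 gx gy df fM e0 => [|m IHm] a s e s0 gx gy df fM e0.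
  exists 0%N => n _; rewrite expr0 divr1.
  apply: le_trans (contour_le (M := M) _ _ _) _; [exact: ltW| |lra].
  exact: on_contour_box.
(* Four times [e / 8] is the allowed [e / 2], and the first term, counted once, is exactly the main
   term at step [m.+1]. *)
pose B b := (if `[<box b (s / 2) z>] then 4 * (s / 2) * M / 2 ^+ m else 0) + e / 8.
have [b bq|N hN] := @contour_split_le f a s B.
  have s2 : 0 < s / 2 by lra.
  have sub w : box b (s / 2) w -> box a s w by exact: quarter_sub.
  rewrite /B; case: asboolP => bz.
    have [hr hi] := quarterP bq.
    have [|||N hN] := IHm b (s / 2) (e / 4) s2 (generic_half gx hr) (generic_half gy hi).
    - by move=> w /sub; exact: df.
    - by move=> w /sub; exact: fM.
    - lra.
    - by exists N => n /hN; lra.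
  have [||N hN] := @goursat f b (s / 2) s2 _ (e / 8).
  - move=> w bw; apply: df; first exact: sub.
    by apply: contra_notN bz => /eqP <-.
  - lra.
  - by exists N => n /hN; lra.
exists N => n /hN h; apply: le_trans h _.
have c0 : 0 <= 4 * (s / 2) * M / 2 ^+ m.
  by rewrite divr_ge0 ?exprn_ge0//; nra.
have -> : 4 * s * M / 2 ^+ m.+1 = 4 * (s / 2) * M / 2 ^+ m.
  by rewrite exprS; field; rewrite expf_neq0.
move: c0; rewrite /B; move: (_ / 2 ^+ m) => c c0.
rewrite !big_cons big_nil /=.
have mx := generic_mid gx; have my := generic_mid gy.
have e8 : 0 <= e / 8 by lra.
(* Off both midlines, at most one of the four conditionals in [B] holds. *)
case: (ltgtP (Re z) (Re a + s / 2)) => hx; last by case: mx.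
all: case: (ltgtP (Im z) (Im a + s / 2)) => hy; last by case: my.
all: clear -hx hy c0 e8.
all: (do 4! [case: asboolP => [[/andP[] + + /andP[]]|_]]); rewrite ?reim; lra.
Qed.

End Goursat.

(** * Cauchy's formula and density of polynomials *)

Section CauchyFormula.
Context {R : realType}.
Local Notation C := R[i].
Implicit Types (f g : C -> C) (a d z w : C) (s : R).

(** The norm of [C] is complex valued; this translates neighbourhoods into real radii. *)
Lemma near0_cabs (P : C -> Prop) :
  (\forall h \near (0 : C), P h) <-> exists2 r : R, 0 < r & forall h, cabs h < r -> P h.
Proof.
split=> [/nbhs_normP[e /= e0 He]|[r r0 Hr]].
  have eE : e = (Re e)%:C by rewrite RRe_real// gtr0_real.
  exists (Re e); first by rewrite -ltcR -eE.
  by move=> h hr; apply: He; rewrite /= sub0r normrN normr_cabs eE ltcR.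
apply/nbhs_normP; exists r%:C; first by rewrite /= ltcR.
by move=> h /=; rewrite sub0r normrN normr_cabs ltcR; exact: Hr.
Qed.

Lemma cdiffP f z : derivable f z 1 <-> cdiff f z.
Proof.
split.
  move=> /cvg_ex[/= D /cvgrPdist_le HD]; exists D => e e0.
  have /HD : 0 < e%:C :> C by rewrite ltcR.
  rewrite near_withinE => /near0_cabs[r r0 Hr].
  exists (r / 2); first by lra.
  move=> w wr; have [->|wz] := eqVneq w z.
    by rewrite !subrr mul0r subrr cabs0 mulr0.
  have h0 : w - z != 0 by rewrite subr_eq0.
  have := Hr (w - z) _ h0; rewrite /= normr_cabs lecR => H.
  have {H} := H ltac:(lra).
  rewrite (_ : (w - z) *: (1 : C) = w - z); last exact: mulr1.
  rewrite subrK (_ : _ *: _ = (w - z)^-1 * (f w - f z))// => H.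
  rewrite (_ : _ - _ = - (w - z) * (D - (w - z)^-1 * (f w - f z))); last by field.
  by rewrite cabsM cabsN mulrC ler_wpM2r ?cabs_ge0.
move=> [D HD]; apply/cvg_ex; exists D; apply/cvgrPdist_le => e e0.
have eE : e = (Re e)%:C by rewrite RRe_real// gtr0_real.
have {}e0 : 0 < Re e by rewrite -ltcR -eE.
have [r r0 Hr] := HD _ e0.
rewrite near_withinE; apply/near0_cabs; exists r => // h hr h0 /=.
rewrite normr_cabs eE lecR.
rewrite (_ : h *: (1 : C) = h); last exact: mulr1.
rewrite (_ : _ *: _ = h^-1 * (f (h + z) - f z))//.
have := Hr (h + z); rewrite addrK => /(_ (ltW hr)) H.
rewrite (_ : _ - _ = - (h^-1 * (f (h + z) - f z - h * D))); last by field.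
by rewrite cabsN cabsM cabsV mulrC ler_pdivrMr// cabs_gt0.
Qed.

(* [1 / u] is a Neumann series around a large point of the imaginary axis. *)
Lemma poly_approx_inv_upper K g (m M : R) : cbounded K -> poly_approx K g ->
  0 < m -> (forall z, K z -> m <= Im (g z) /\ cabs (g z) <= M) ->
  poly_approx K (fun z => (g z)^-1).
Proof.
move=> bK hg m0 gK.
(* With [c] the point of height [T], the squared distance from [c] to [g z] is at most
   [M ^+ 2 - 2 * T * m + T ^+ 2], hence at most [(T - m / 2) ^+ 2]. *)
have [T T0 hT] : exists2 T : R, m <= T & M ^+ 2 <= T * m.
  exists (M ^+ 2 / m + m); first by rewrite lerDr divr_ge0 ?sqr_ge0// ltW.
  by rewrite mulrDl divfK ?gt_eqF// lerDl -expr2 sqr_ge0.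
have T1 : 0 < T by exact: lt_le_trans T0.
pose c : C := 'i * T%:C.
have cc : cabs c = T by rewrite cabsM cabs_i cabs_real mul1r gtr0_norm.
have c0 : c != 0 by rewrite -cabs_gt0 cc.
have hu : poly_approx K (fun z => 1 - c^-1 * g z).
  apply: poly_approxB; first exact: poly_approx_cst.
  by apply: poly_approxM => //; exact: poly_approx_cst.
have u1 z : K z -> cabs (1 - c^-1 * g z) <= (T - m / 2) / T.
  move=> /gK[k1 k2].
  rewrite (_ : 1 - c^-1 * g z = c^-1 * (c - g z)); last by rewrite mulrBr mulVf.
  rewrite cabsM cabsV cc mulrC ler_pM2r ?invr_gt0//.
  have M0 : 0 <= M by exact: le_trans (cabs_ge0 _) k2.
  move: k2; rewrite !cabs_le_sqr//; last lra.
  rewrite /c; move: (g z) k1 => u k1; rewrite !reim => k2.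
  rewrite [leLHS](_ : _ = Re u ^+ 2 + Im u ^+ 2 - 2 * T * Im u + T ^+ 2); last by ring.
  nra.
have t1 : (T - m / 2) / T < 1 by rewrite ltr_pdivrMr//; lra.
apply: (poly_approx_eq (poly_approxM bK (@poly_approx_cst _ _ c^-1)
  (poly_approx_neumann bK hu t1 u1))) => z _ /=.
by rewrite subKr [(c^-1 * _)^-1]invfM mulrA mulfV ?mul1r// invr_eq0.
Qed.

Lemma cdiff_continuous f z : cdiff f z -> forall e : R, 0 < e ->
  exists2 r : R, 0 < r & forall w, cabs (w - z) <= r -> cabs (f w - f z) <= e.
Proof.
move=> [D HD] e e0; have [r r0 Hr] := HD _ ltr01.
have D0 := cabs_ge0 D.
have q0 : 0 < e / (1 + cabs D) by rewrite divr_gt0//; lra.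
exists (Num.min r (e / (1 + cabs D))); first by rewrite lt_min r0.
move=> w; rewrite le_min => /andP[/Hr h1 h2].
apply: le_trans (cabs_le_dist _ ((w - z) * D)) _; rewrite cabsM.
move: h2; rewrite ler_pdivlMr; last lra.
lra.
Qed.

Lemma box_quarter b (t : R) w : 0 < t -> box b t w ->
  exists2 c, c \in quarter b (t / 2) & box c (t / 2) w.
Proof.
move=> t0 [/andP[w1 w2] /andP[w3 w4]].
have [x12|x12] := leP (Re w) (Re b + t / 2);
have [y12|y12] := leP (Im w) (Im b + t / 2).
- by exists b; [rewrite !inE eqxx|split; apply/andP; split; lra].
- exists (b + 'i * (t / 2)%:C); first by rewrite !inE eqxx !orbT.
  by split; apply/andP; rewrite !reim; split; lra.
- exists (b + (t / 2)%:C); first by rewrite !inE eqxx !orbT.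
  by split; apply/andP; rewrite !reim; split; lra.
- exists (b + (t / 2)%:C + 'i * (t / 2)%:C); first by rewrite !inE eqxx !orbT.
  by split; apply/andP; rewrite !reim; split; lra.
Qed.

(** Bisection stands in for compactness; the sum of the four bounds dominates each of them. *)
Lemma box_bounded (f : C -> C) a s : 0 < s ->
  (forall z, box a s z -> exists2 r : R, 0 < r &
     exists M : R, forall w, cabs (w - z) <= r -> cabs (f w) <= M) ->
  exists2 M : R, 0 <= M & forall w, box a s w -> cabs (f w) <= M.
Proof.
move=> s0 H.
apply: (bisection_ind (P := fun a s => exists2 M : R, 0 <= M &
   forall w, box a s w -> cabs (f w) <= M)) s0 _ => [b t t0 Hq|z /H[r r0 [M HM]]].
  have [F hF] : exists F : C -> R, forall c, c \in quarter b (t / 2) ->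
      0 <= F c /\ forall w, box c (t / 2) w -> cabs (f w) <= F c.
    have [|F hF] := @choice _ _ (fun c M => c \in quarter b (t / 2) ->
      0 <= M /\ forall w, box c (t / 2) w -> cabs (f w) <= M).
      move=> c; have [/Hq[M M0 hM]|cq] := boolP (c \in quarter b (t / 2)).
        by exists M.
      by exists 0.
    by exists F.
  exists (\sum_(c <- quarter b (t / 2)) F c).
    by rewrite big_seq sumr_ge0// => c /hF[].
  move=> w bw; have [c cq cw] := box_quarter t0 bw.
  have [F0 /(_ _ cw) h] := hF _ cq; apply: le_trans h _.
  rewrite (big_rem c cq) lerDl big_seq sumr_ge0// => x /mem_rem xq; by case: (hF _ xq).
exists (r / 2); first by lra.
move=> b t /andP[t0 tr] bz; exists (Num.max 0 M); first by rewrite le_max lexx.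
move=> w /(box_dist bz) wz; rewrite le_max HM ?orbT//; lra.
Qed.

Lemma Re_invc z : Re z^-1 = Re z / (Re z ^+ 2 + Im z ^+ 2).
Proof. by case: z. Qed.

Lemma Im_invc z : Im z^-1 = - Im z / (Re z ^+ 2 + Im z ^+ 2).
Proof. by case: z => x y /=; rewrite mulNr. Qed.

Section InSquare.
Context (f : C -> C) (X : R) (df : forall z, cdiff f z) (X0 : 0 < X).

(** The contour bounds the centred square of half side [2 * X]. It is at distance [X] from
    [square 0 X], where the formula is wanted, and [X / 2] from [square 0 (3 / 2 * X)], which leaves
    room to move to generic points. *)
Definition frame_corner : C := (- (2 * X)) +i* (- (2 * X)).
Definition frame_side : R := 4 * X.
Local Notation a := frame_corner.
Local Notation s := frame_side.
Definition cauchy_kernel n z := contour (fun w => (w - z)^-1) n a s.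
Definition cauchy_sum n z := contour (fun w => f w / (w - z)) n a s.
Local Notation k := cauchy_kernel.
Local Notation G := cauchy_sum.

Lemma frame_side_gt0 : 0 < s.
Proof. by rewrite mulr_gt0. Qed.

(** The contour together with its whole exterior, so that poles on it can be pushed outwards without
    leaving it. *)
Definition frame w := 2 * X <= `|Re w| \/ 2 * X <= `|Im w|.

Lemma on_contour_frame : on_contour a s frame.
Proof.
have X1 := X0.
apply: on_contourP; last exact: (ltW frame_side_gt0).
move=> w _; rewrite /frame_corner /frame_side /= => -[] E; [left|left|right|right].
all: by rewrite E ler_normr; apply/orP; first [left; lra|right; lra].
Qed.

Lemma on_contour_frameW (P : C -> Prop) : (forall w, frame w -> P w) -> on_contour a s P.
Proof. by move=> H; case: on_contour_frame => h1 h2 h3 h4; split=> t t1; apply: H; auto. Qed.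

Lemma frame_far (Y : R) w z : frame w -> square 0 Y z -> 2 * X - Y <= cabs (w - z).
Proof.
have X1 := X0.
move=> fw /square0E[z1 z2].
have h (x y : R) : 2 * X <= `|x| -> `|y| <= Y -> 2 * X - Y <= `|x - y|.
  by move=> hx hy; have := ler_distD y x 0; rewrite !subr0; lra.
case: fw => fw.
  by apply: le_trans (Re_cabs _); rewrite !reim; exact: h.
by apply: le_trans (Im_cabs _); rewrite !reim; exact: h.
Qed.

Lemma frame_pole w : frame w -> poly_approx (square 0 X) (fun z => (w - z)^-1).
Proof.
have X1 := X0.
move=> fw.
have bK : cbounded (square 0 X) by apply: (@square0_bounded _ X).
have ray u : cabs u = 1 -> (forall t : R, 0 <= t -> frame (w + t%:C * u)) ->
    poly_approx (square 0 X) (fun z => (w - z)^-1).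
  move=> u1 H; apply: (pole_ray bK X0 u1) => t z t0 Xz.
  by have := frame_far (H t t0) Xz; lra.
case: fw; rewrite ler_normr => /orP[] fw.
- apply: (ray 1 cabs1) => t t0; left; rewrite !reim ler_normr; apply/orP; left.
  by rewrite /=; lra.
- apply: (ray (-1)) => [|t t0]; first by rewrite cabsN cabs1.
  by left; rewrite !reim ler_normr; apply/orP; right; rewrite /=; lra.
- apply: (ray 'i cabs_i) => t t0; right; rewrite !reim ler_normr; apply/orP; left.
  by lra.
- apply: (ray (- 'i)) => [|t t0]; first by rewrite cabsN cabs_i.
  by right; rewrite !reim ler_normr; apply/orP; right; lra.
Qed.

Lemma cauchy_kernel_approx n : poly_approx (square 0 X) (k n).
Proof.
apply: (@contour_approx _ _ (fun w z => (w - z)^-1)).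
  exact: (@square0_bounded _ X).
exact: on_contour_frameW frame_pole.
Qed.

Lemma cauchy_sum_approx n : poly_approx (square 0 X) (G n).
Proof.
have bK : cbounded (square 0 X) by apply: (@square0_bounded _ X).
apply: (@contour_approx _ _ (fun w z => f w / (w - z))) => //.
apply: on_contour_frameW => w /frame_pole h; apply: poly_approxM => //.
exact: poly_approx_cst.
Qed.

Lemma cauchy_kernel_le n z : square 0 (3 / 2 * X) z -> cabs (k n z) <= 32.
Proof.
have X1 := X0.
(* Perimeter [16 * X] times the inverse of the distance [X / 2]. *)
move=> Xz; rewrite (_ : 32 = 4 * s * (2 / X)); last first.
  by rewrite /frame_side; field; rewrite gt_eqF.
apply: contour_le; first exact: (ltW frame_side_gt0).
apply: on_contour_frameW => w fw; rewrite cabsV.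
have h := frame_far fw Xz.
have iX : 2 / X = (X / 2)^-1 by rewrite invf_div.
by rewrite iX lef_pV2 ?posrE; lra.
Qed.

Lemma cauchy_kernel_dist (M : R) (c : C) w z z1 : frame w -> square 0 (3 / 2 * X) z ->
  square 0 (3 / 2 * X) z1 -> cabs c <= M ->
  cabs (c / (w - z) - c / (w - z1)) <= M * (4 / X ^+ 2) * cabs (z - z1).
Proof.
have X1 := X0.
move=> fw Xz Xz1 cM.
have h := frame_far fw Xz; have h1 := frame_far fw Xz1.
have wz : w - z != 0 by rewrite -cabs_gt0; lra.
have wz1 : w - z1 != 0 by rewrite -cabs_gt0; lra.
have -> : c / (w - z) - c / (w - z1) = c * ((w - z)^-1 * (w - z1)^-1) * (z - z1).
  by field; rewrite ?wz ?wz1.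
rewrite !cabsM ler_wpM2r ?cabs_ge0// ler_pM ?cabs_ge0 ?mulr_ge0 ?cabs_ge0//.
rewrite (_ : 4 / X ^+ 2 = 2 / X * (2 / X)); last by field; rewrite gt_eqF.
have iX : 2 / X = (X / 2)^-1 by rewrite invf_div.
by rewrite ler_pM ?cabs_ge0// cabsV iX lef_pV2 ?posrE; lra.
Qed.

(** Each side contributes at least 2/9: its term is [s * y] over the squared modulus of [w - z],
    where [y >= X] is the distance from [z] to the line of that side, [s = 4 * X], and the squared
    modulus is at most [18 * X ^+ 2]. *)
Lemma cauchy_kernel_Im n z : square 0 X z -> 8 / 9 <= Im (k n z).
Proof.
have X1 := X0.
move=> /square0E[/ler_normlP[x1 x2] /ler_normlP[y1 y2]].
have key (v : C) (y : R) : `|Re v| <= 3 * X -> `|Im v| <= 3 * X -> X <= y ->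
    y = Re v \/ y = - Re v \/ y = Im v \/ y = - Im v ->
    2 / 9 <= s * (y / (Re v ^+ 2 + Im v ^+ 2)).
  move=> /ler_normlP[p1 p2] /ler_normlP[q1 q2] Xy yv.
  have n1 : 0 < Re v ^+ 2 + Im v ^+ 2.
    by case: yv => [|[|[|]]] yE; rewrite yE in Xy; nra.
  have n2 : Re v ^+ 2 + Im v ^+ 2 <= 18 * X ^+ 2 by nra.
  by rewrite mulrA ler_pdivlMr// /frame_side; nra.
have ImN_D x y : - Im (x + y) = - Im x + - Im y :> R by rewrite Im_addc opprD.
have Rea : Re a = - (2 * X) by [].
have Ima : Im a = - (2 * X) by [].
rewrite /cauchy_kernel; move: a Rea Ima => b Rea Ima.
have b1 : 2 / 9 <= Im (seg_sum (fun w => (w - z)^-1) n b s%:C).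
  apply: (@seg_sum_ge R (fun x => Im x) _ _ _ _ _ (@Im_addc R)) => t /andP[t0 t1].
  set v := _ - z; rewrite (_ : Im _ = s * (- Im v / (Re v ^+ 2 + Im v ^+ 2))); last first.
    by rewrite Im_mulc Re_invc Im_invc !reim; ring.
  by apply: key; [| | |auto]; rewrite /v ?reim ?Rea ?Ima /frame_side;
    first [apply/ler_normlP; split; nra|nra].
have b2 : 2 / 9 <= Im (seg_sum (fun w => (w - z)^-1) n (b + s%:C) ('i * s%:C)).
  apply: (@seg_sum_ge R (fun x => Im x) _ _ _ _ _ (@Im_addc R)) => t /andP[t0 t1].
  set v := _ - z; rewrite (_ : Im _ = s * (Re v / (Re v ^+ 2 + Im v ^+ 2))); last first.
    by rewrite !Im_mulc Re_mulc Re_invc Im_invc !reim; ring.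
  by apply: key; [| | |auto]; rewrite /v ?reim ?Rea ?Ima /frame_side;
    first [apply/ler_normlP; split; nra|nra].
have b3 : 2 / 9 <= - Im (seg_sum (fun w => (w - z)^-1) n (b + 'i * s%:C) s%:C).
  apply: (@seg_sum_ge R (fun x => - Im x) _ _ _ _ _ ImN_D) => t /andP[t0 t1].
  set v := _ - z; rewrite (_ : - Im _ = s * (Im v / (Re v ^+ 2 + Im v ^+ 2))); last first.
    by rewrite Im_mulc Re_invc Im_invc !reim; ring.
  by apply: key; [| | |auto]; rewrite /v ?reim ?Rea ?Ima /frame_side;
    first [apply/ler_normlP; split; nra|nra].
have b4 : 2 / 9 <= - Im (seg_sum (fun w => (w - z)^-1) n b ('i * s%:C)).
  apply: (@seg_sum_ge R (fun x => - Im x) _ _ _ _ _ ImN_D) => t /andP[t0 t1].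
  set v := _ - z; rewrite (_ : - Im _ = s * (- Re v / (Re v ^+ 2 + Im v ^+ 2))); last first.
    by rewrite !Im_mulc Re_mulc Re_invc Im_invc !reim; ring.
  by apply: key; [| | |auto]; rewrite /v ?reim ?Rea ?Ima /frame_side;
    first [apply/ler_normlP; split; nra|nra].
rewrite /contour Im_addc Im_oppc Im_addc Im_oppc Im_addc.
lra.
Qed.

(* Cauchy's formula in the limit. The value [2 i pi] of the limit of [k n] is not
   needed: it is enough that [k n] stays away from 0. *)
Definition cauchy_error n z := f z * k n z - G n z.
Local Notation E := cauchy_error.

Lemma quotient_cdiff z1 w : w != z1 -> cdiff (fun w => (f w - f z1) / (w - z1)) w.
Proof.
move=> wz; apply/cdiffP.
apply: (@derivableM _ _ (fun w => f w - f z1) (fun w => (w - z1)^-1)).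
  by apply: derivableB; [exact/cdiffP|exact: derivable_cst].
apply: derivableV; first by rewrite subr_eq0.
by apply: derivableB; [exact: derivable_id|exact: derivable_cst].
Qed.

(** Up to sign, the error is the contour sum of the difference quotient of [f] at [z1], which is
    differentiable off [z1] and bounded near it. *)
Lemma cauchy_error_generic z1 (e : R) : generic (Re z1) (Re a) s -> generic (Im z1) (Im a) s ->
  0 < e -> exists N, forall n, (N <= n)%N -> cabs (E n z1) <= e.
Proof.
move=> g1 g2 e0.
pose phi w := (f w - f z1) / (w - z1).
have [M M0 phiM] : exists2 M : R, 0 <= M & forall w, box a s w -> cabs (phi w) <= M.
  apply: (box_bounded frame_side_gt0) => z _; have [->|zz1] := eqVneq z z1.
    have [D /(_ 1 ltr01)[r r0 hr]] := df z1; exists r => //.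
    exists (cabs D + 1) => w /hr; rewrite /phi.
    have [->|wz] := eqVneq w z1.
      by rewrite subrr mul0r cabs0 => _; have := cabs_ge0 D; lra.
    have wz' : 0 < cabs (w - z1) by rewrite cabs_gt0 subr_eq0.
    have := cabs_le_dist (f w - f z1) ((w - z1) * D).
    rewrite cabsM => h1 h2; rewrite cabsM cabsV ler_pdivrMr//; lra.
  have [r r0 hr] := cdiff_continuous (quotient_cdiff zz1) ltr01.
  exists r => //; exists (cabs (phi z) + 1) => w /hr h.
  by have := cabs_le_dist (phi w) (phi z); rewrite -/(phi w) -/(phi z) in h; lra.
have [N hN] := goursat_except frame_side_gt0 M0 g1 g2 (fun w _ => @quotient_cdiff z1 w) phiM e0.
exists N => n /hN; rewrite (_ : (fun w => (f w - f z1) / (w - z1)) =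
  (fun w => f w / (w - z1) - f z1 * (w - z1)^-1)).
  by rewrite contourB cabs_distC.
by apply/funext => w; rewrite mulrBl.
Qed.

(** Independent of [n], so smallness at a generic point passes to all its neighbours at the same
    depth. *)
Lemma cauchy_error_dist (M : R) n z z1 : square 0 (3 / 2 * X) z -> square 0 (3 / 2 * X) z1 ->
  0 <= M -> (forall w, box a s w -> cabs (f w) <= M) -> box a s z1 ->
  cabs (E n z - E n z1) <=
    32 * cabs (f z - f z1) + (64 / X + 64 / X) * M * cabs (z - z1).
Proof.
have X1 := X0; move=> Xz Xz1 M0 fM bz1.
have -> : E n z - E n z1 =
    (f z - f z1) * k n z + f z1 * (k n z - k n z1) - (G n z - G n z1).
  by rewrite /cauchy_error; ring.
have hdiff (g : C -> C) (B : R) : (forall w, box a s w -> cabs (g w) <= B) ->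
    cabs (contour (fun w => g w / (w - z)) n a s -
          contour (fun w => g w / (w - z1)) n a s) <= 64 / X * B * cabs (z - z1).
  move=> gB; rewrite -[X in _ - X]mul1r -contourB.
  have -> : 64 / X * B * cabs (z - z1) = 4 * s * (B * (4 / X ^+ 2) * cabs (z - z1)).
    by rewrite /frame_side; field; rewrite gt_eqF.
  apply: contour_le; first exact: (ltW frame_side_gt0).
  have [f1 f2 f3 f4] := on_contour_frame.
  have [b1 b2 b3 b4] := on_contour_box frame_side_gt0 (fun w (h : box a s w) => h).
  by split=> t t1; rewrite mul1r; apply: cauchy_kernel_dist => //; auto.
have hk : cabs (f z1 * (k n z - k n z1)) <= M * (64 / X * cabs (z - z1)).
  rewrite cabsM ler_pM ?cabs_ge0 ?fM//.
  have := hdiff (fun=> 1) 1; rewrite mulr1 /cauchy_kernel.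
  under eq_fun do rewrite mul1r.
  under [in X in _ - X]eq_fun do rewrite mul1r.
  by apply=> w _; rewrite cabs1.
have hG : cabs (G n z - G n z1) <= 64 / X * M * cabs (z - z1) by exact: hdiff.
have h := cauchy_kernel_le n Xz.
apply: le_trans (cabsB _ _) _; apply: le_trans (lerD (cabsD _ _) (lexx _)) _.
have : cabs ((f z - f z1) * k n z) <= 32 * cabs (f z - f z1).
  by rewrite cabsM mulrC ler_wpM2r ?cabs_ge0.
lra.
Qed.

(** Each point has a generic point nearby, which gives a common [N] locally; bisection makes it
    global. *)
Lemma cauchy_error_unif (e : R) : 0 < e ->
  exists N, forall n z, (N <= n)%N -> square 0 X z -> cabs (E n z) <= e.
Proof.
have X1 := X0; move=> e0.
have [M M0 fM] : exists2 M : R, 0 <= M & forall w, box a s w -> cabs (f w) <= M.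
  apply: (box_bounded frame_side_gt0) => z _.
  have [r r0 hr] := cdiff_continuous (df z) ltr01; exists r => //.
  exists (cabs (f z) + 1) => w /hr h.
  by have := cabs_le_dist (f w) (f z); lra.
pose P b t := exists N, forall n z, (N <= n)%N -> box b t z -> square 0 X z ->
  cabs (E n z) <= e.
suff [N hN] : P (- X%:C - 'i * X%:C) (2 * X).
  exists N => n z Nn Xz; apply: hN => //.
  move/square0E: Xz => [/ler_normlP[x1 x2] /ler_normlP[y1 y2]].
  by split; apply/andP; rewrite !reim; split; lra.
apply: bisection_ind; last 2 first.
- by lra.
- move=> z0 [/andP[]]; rewrite !reim => x1 x2 /andP[y1 y2].
  (* The factor 32 and two comparisons with [f z0] make [64 * (e / 256) = e / 4]. The distance term
     and the generic point cost [e / 4] each. *)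
  have [|r1 r10 hr1] := @cdiff_continuous f z0 (df z0) (e / 16 / 16); first by lra.
  have [D DE] : exists D : R, D = 8 * (8 * (8 * (M + 1))) by eexists.
  have D0 : 0 < D by lra.
  pose r := Num.min (Num.min r1 X) (e * X / D).
  have [r0 rr1 rX rM] : [/\ 0 < r, r <= r1, r <= X & r * D <= e * X].
    split; rewrite /r.
    - by rewrite !lt_min r10 X0 divr_gt0// mulr_gt0.
    - by rewrite !ge_min lexx.
    - by rewrite !ge_min lexx orbT.
    - by rewrite -ler_pdivlMr// ge_min lexx orbT.
  move: r r0 rr1 rX rM => r r0 rr1 rX rM.
  have {D DE D0 rM} rM : 128 * M * r <= e / 4 * X by rewrite DE in rM; lra.
  have r4 : 0 < r / 4 by lra.
  have [x hx gx] := @generic_near _ (Re z0) (Re a) s _ frame_side_gt0 r4.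
  have [y hy gy] := @generic_near _ (Im z0) (Im a) s _ frame_side_gt0 r4.
  have e4 : 0 < e / 4 by lra.
  have [N hN] := @cauchy_error_generic (x +i* y) _ gx gy e4.
  exists (r / 4) => // b t /andP[t0 tr] bz0; exists N => n z Nn bz Xz.
  have := hN n Nn.
  have [z1 Rz1 Iz1] : exists2 z1 : C, Re z1 = x & Im z1 = y by exists (x +i* y).
  rewrite (_ : x +i* y = z1); last by apply: complex_ext.
  move=> Ez1.
  have z1z0 : cabs (z1 - z0) <= r / 2.
    apply: le_trans (cabs_ReIm _) _; rewrite !Re_addc !Im_addc Re_oppc Im_oppc.
    by rewrite Rz1 Iz1; lra.
  have zz0 := box_dist bz0 bz.
  have [/ler_normlP[hx1 hx2] /ler_normlP[hy1 hy2]] := conj hx hy.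
  have Xz1 : square 0 (3 / 2 * X) z1.
    apply/square0E; rewrite Rz1 Iz1; split; apply/ler_normlP; split; lra.
  have bz1 : box a s z1.
    have Rea : Re a = - (2 * X) by [].
    have Ima : Im a = - (2 * X) by [].
    by split; apply/andP; rewrite ?Rea ?Ima ?Rz1 ?Iz1 /frame_side; split; lra.
  have Xz' : square 0 (3 / 2 * X) z.
    by move/square0E: Xz => -[h1 h2]; apply/square0E; split; lra.
  have := cauchy_error_dist n Xz' Xz1 M0 fM bz1.
  have h1 := hr1 z ltac:(lra); have h2 := hr1 z1 ltac:(lra).
  have h3 := cabs_dist_trans (f z0) (f z) (f z1); rewrite (cabs_distC (f z0)) in h3.
  have h4 := cabs_dist_trans z0 z z1; rewrite (cabs_distC z0) in h4.
  have h5 : (64 / X + 64 / X) * M * cabs (z - z1) <= e / 4.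
    have -> : (64 / X + 64 / X) * M * cabs (z - z1) = 128 * M * cabs (z - z1) / X.
      by field; rewrite gt_eqF.
    by rewrite ler_pdivrMr//; have := cabs_ge0 (z - z1); nra.
  have := cabs_le_dist (E n z) (E n z1).
  lra.
move=> b t t0 Pq.
have [N hN] : exists N, forall c, c \in quarter b (t / 2) -> forall n z,
    (N <= n)%N -> box c (t / 2) z -> square 0 X z -> cabs (E n z) <= e.
  elim: (quarter b (t / 2)) Pq => [|c q IHq] H; first by exists 0%N.
  have [N1 h1] := H c (mem_head _ _).
  have [|N2 h2] := IHq; first by move=> x xq; apply: H; rewrite inE xq orbT.
  exists (maxn N1 N2) => x; rewrite inE => /orP[/eqP ->|xq] n z;
    rewrite geq_max => /andP[n1 n2].
    exact: h1.
  exact: h2.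
exists N => n z Nn /(box_quarter t0)[c cq cz]; exact: hN cq _ _ Nn cz.
Qed.

(** [f] is close to [G N] over [k N]. Both have their poles on the contour, from where they are
    pushed out, and [k N] has imaginary part bounded below, so its inverse is approximable too. *)
Lemma cdiff_poly_approx : poly_approx (square 0 X) f.
Proof.
have X1 := X0.
have bK : cbounded (square 0 X) by apply: (@square0_bounded _ X).
apply: poly_approx_unif => e e0.
have [N hN] := @cauchy_error_unif (e / 2) ltac:(lra).
have kX z : square 0 X z -> 8 / 9 <= Im (k N z) /\ cabs (k N z) <= 32.
  move=> Xz; split; first exact: cauchy_kernel_Im.
  by apply: cauchy_kernel_le; move/square0E: Xz => -[h1 h2]; apply/square0E; split; lra.
have hG := cauchy_sum_approx N.
have hi : poly_approx (square 0 X) (fun z => (k N z)^-1).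
  have k89 : 0 < 8 / 9 :> R by lra.
  exact: (poly_approx_inv_upper bK (@cauchy_kernel_approx N) k89 kX).
have {}hN z : square 0 X z -> cabs (f z * k N z - G N z) <= e / 2.
  by move=> Xz; exact: hN.
move: (k N) (G N) hN kX hi hG => kN GN hN kX hi hG.
exists (fun z => GN z * (kN z)^-1); first exact: poly_approxM.
move=> z Xz; have [k1 _] := kX z Xz.
have k0 : kN z != 0 by apply/eqP => k0; rewrite k0 /= in k1; lra.
have -> : f z - GN z / kN z = (f z * kN z - GN z) / kN z by field.
have k2 : 8 / 9 <= cabs (kN z).
  by have := Im_cabs (kN z); have := ler_norm (Im (kN z)); lra.
rewrite cabsM cabsV ler_pdivrMr; last lra.
by have := hN z Xz; nra.
Qed.

End InSquare.
End CauchyFormula.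

(** * Gluing over a grid of cells; one Runge step *)

Section GridGluing.
Context {R : realType}.
Local Notation C := R[i].
Implicit Types (K : set C) (g : C -> C) (p : {poly C}).

(** Consecutive slabs leave gaps of width 2 centred at the odd multiples of [s]. *)
Definition in_slab (s : R) (u : int) (x : R) := `|x - 2 * s * u%:~R| <= s - 1.

Lemma in_slab_cut (s x : R) (u m : int) : 0 < s -> in_slab s u x ->
  (u <= m -> x <= (2 * m%:~R + 1) * s - 1) /\ (m < u -> (2 * m%:~R + 1) * s + 1 <= x).
Proof.
move=> s0 /ler_normlP[h1 h2]; split=> um.
  have : u%:~R <= m%:~R :> R by rewrite ler_int.
  by nra.
have : m%:~R + 1 <= u%:~R :> R by rewrite -intrD1 ler_int lezD1.
by nra.
Qed.

Lemma glue_slabs_Re K g (s X : R) : 0 < s -> K `<=` square 0 X ->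
  (forall z, K z -> exists u : int, in_slab s u (Re z)) ->
  (forall u : int, poly_approx [set z | K z /\ in_slab s u (Re z)] g) ->
  poly_approx K g.
Proof.
move=> s0 KX Kslab Kg.
pose N := Num.truncn (`|X| / s).
have hN : `|X| < s * N.+1%:R by rewrite mulrC -ltr_pdivrMr// truncnS_gt.
have hX := ler_norm X; have hX0 := normr_ge0 X.
(* The offset makes [L 0] empty and [L (2 * N.+2)] all of [K]. *)
pose m n : int := n%:Z - N.+2%:Z.
have mE n : (m n)%:~R = n%:R - N.+2%:R :> R by rewrite /m rmorphB.
have N2 : N.+2%:R = N.+1%:R + 1 :> R by rewrite natr1.
pose L n := [set z | K z /\ Re z <= (2 * (m n)%:~R + 1) * s].
have LX n : L n `<=` square 0 X by move=> z [/KX].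
suff H n : poly_approx (L n) g.
  apply: poly_approx_sub (H (2 * N.+2)%N) => z Kz; split=> //.
  have /square0E[/ler_normlP[_ zX] _] := KX _ Kz.
  rewrite mE natrM N2.
  by move: (N.+1%:R) hN => t hN; nra.
elim: n => [|n IHn].
  move=> e e0; exists 0 => z [Kz hz]; exfalso.
  have /square0E[/ler_normlP[zX _] _] := KX _ Kz.
  move: hz; rewrite mE sub0r N2.
  by move: (N.+1%:R) hN => t hN; nra.
have mS : m n.+1 = m n + 1 by rewrite /m -addn1 PoszD; ring.
apply: (@glue_Re _ _ _ X ((2 * (m n)%:~R + 1) * s - 1) ((2 * (m n)%:~R + 1) * s + 1)).
- exact: LX.
- lra.
- move=> z [/Kslab[u zu] _]; have [h1 h2] := in_slab_cut (m n) s0 zu.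
  by case: (leP u (m n)) => um; [left; exact: h1|right; exact: h2].
- apply: poly_approx_sub IHn => z [[Kz _] hz]; split=> //; lra.
- apply: poly_approx_sub (Kg (m n + 1)) => z [[Kz hz1] hz2]; split=> //.
  have [u zu] := Kslab _ Kz.
  (* Between two consecutive cuts there is exactly one slab. *)
  suff -> : m n + 1 = u by [].
  have [h1 h2] := in_slab_cut (m n) s0 zu.
  have [h3 h4] := in_slab_cut (m n.+1) s0 zu.
  apply/eqP; rewrite eq_le; apply/andP; split.
    by rewrite lezD1 ltNge; apply/negP => /h1; lra.
  by rewrite -mS leNgt; apply/negP => /h4; lra.
Qed.

Lemma glue_slabs_Im K g (s X : R) : 0 < s -> K `<=` square 0 X ->
  (forall z, K z -> exists u : int, in_slab s u (Im z)) ->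
  (forall u : int, poly_approx [set z | K z /\ in_slab s u (Im z)] g) ->
  poly_approx K g.
Proof.
move=> s0 KX Kslab Kg; apply/poly_approx_rot.
have ImE (z : C) : Im ('i * z) = Re z by rewrite !reim; ring.
have ReE (z : C) : Re ('i * z) = - Im z by rewrite !reim; ring.
apply: (@glue_slabs_Re _ _ s X) => //.
- move=> z /KX/square0E; rewrite ReE ImE normrN => -[? ?].
  by apply/square0E.
- by move=> z /Kslab; rewrite ImE.
- move=> u; have /poly_approx_rot := Kg u; apply: poly_approx_sub => z /=.
  by rewrite ImE.
Qed.

Lemma glue_grid K g (s X : R) : 0 < s -> K `<=` square 0 X ->
  (forall z, K z -> exists u v : int, in_slab s u (Re z) /\ in_slab s v (Im z)) ->
  (forall u v : int,
     poly_approx [set z | [/\ K z, in_slab s u (Re z) & in_slab s v (Im z)]] g) ->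
  poly_approx K g.
Proof.
move=> s0 KX Kcell Kg.
apply: (glue_slabs_Re s0 KX) => [z /Kcell[u [v [? ?]]]|u]; first by exists u.
apply: (@glue_slabs_Im _ _ s X) => //.
- by move=> z [/KX].
- by move=> z [/Kcell[u' [v [? ?]]] _]; exists v.
- by move=> v; apply: poly_approx_sub (Kg u v) => z [[]].
Qed.

Definition lattice_pt (s : R) (u v : int) : C :=
  (2 * s * u%:~R)%:C + 'i * (2 * s * v%:~R)%:C.

Lemma Re_lattice s u v : Re (lattice_pt s u v) = 2 * s * u%:~R.
Proof. by rewrite !reim; ring. Qed.

Lemma Im_lattice s u v : Im (lattice_pt s u v) = 2 * s * v%:~R.
Proof. by rewrite !reim; ring. Qed.

Lemma square_lattice s u v z : square (lattice_pt s u v) (s - 1) z <->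
  in_slab s u (Re z) /\ in_slab s v (Im z).
Proof. by rewrite /square /mkset Re_lattice Im_lattice. Qed.

Lemma in_slab_inj (s x : R) (u v : int) : 0 < s -> in_slab s u x -> in_slab s v x -> u = v.
Proof.
move=> s0 hu hv; apply/eqP; rewrite eq_le; apply/andP.
have [h1 h2] := in_slab_cut u s0 hv; have [h3 h4] := in_slab_cut v s0 hu.
have [h5 h6] := in_slab_cut u s0 hu; have [h7 h8] := in_slab_cut v s0 hv.
split; rewrite leNgt; apply/negP => H.
  by have := h4 H; have := h7 (lexx _); lra.
by have := h2 H; have := h5 (lexx _); lra.
Qed.

(* Cells of the grid never meet the lines at odd multiples of [s], so the old
   square, whose sides lie just inside such lines, is cut off first and the
   remaining cells are then separated from each other. *)
Lemma runge_stage (s : R) (m : nat) (X e : R) (p0 P : {poly C}) : 1 <= s -> 0 < e ->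
  let Y := (2 * m%:R + 1) * s in
  exists p, (forall z, square 0 (Y - 1) z -> cabs (p.[z] - p0.[z]) <= e) /\
    forall u v : int, Y < `|2 * s * u%:~R| \/ Y < `|2 * s * v%:~R| ->
      `|2 * s * u%:~R| <= X -> `|2 * s * v%:~R| <= X ->
      forall z, square (lattice_pt s u v) (s - 1) z ->
        cabs (p.[z] - P.[z - lattice_pt s u v]) <= e.
Proof.
move=> s1 e0 Y; have s0 : 0 < s by lra.
have m0 : 0 <= m%:R :> R by [].
have Y0 : 1 <= Y by rewrite /Y; nra.
pose S : set C := square 0 (Y - 1).
pose far (u : int) := Y < `|2 * s * u%:~R|.
pose cell u v z := [/\ far u \/ far v, `|2 * s * u%:~R| <= X, `|2 * s * v%:~R| <= X,
  in_slab s u (Re z) & in_slab s v (Im z)].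
pose L : set C := [set z | exists u v, cell u v z].
have far_out u x : far u -> in_slab s u x -> Y + 1 <= `|x|.
  move=> fu xu; rewrite ler_normr; move: fu; rewrite /far ltr_normr => /orP[] fu.
    have mu : (m%:Z < u)%R.
      have : m%:R < u%:~R :> R by rewrite /Y in fu; nra.
      by rewrite -[m%:R]/((m%:Z)%:~R) ltr_int.
    apply/orP; left; have [_ /(_ mu)] := in_slab_cut m%:Z s0 xu.
    by rewrite /Y.
  have mu : (u <= - m%:Z - 1)%R.
    have : u%:~R < (- m%:Z)%:~R :> R by rewrite rmorphN /=; rewrite /Y in fu; nra.
    by rewrite ltr_int => ?; rewrite lerBrDr lezD1.
  apply/orP; right; have [/(_ mu) + _] := in_slab_cut (- m%:Z - 1) s0 xu.
  by rewrite rmorphB rmorphN /= /Y; lra.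
have LS z : L z -> ~ S z.
  move=> [u [v [[fu|fv] _ _ hu hv]]] /square0E[h1 h2].
    by have := far_out _ _ fu hu; lra.
  by have := far_out _ _ fv hv; lra.
(* The coordinate of [z] relative to the centre of its cell, well defined because slabs are
   disjoint. *)
have ex (z : C) : exists w : C, forall u v, cell u v z -> w = z - lattice_pt s u v.
  have [[u [v zuv]]|nz] := pselect (L z); last first.
    by exists 0 => u v h; case: nz; exists u, v.
  exists (z - lattice_pt s u v) => u' v' zuv'.
  case: zuv => _ _ _ h1 h2; case: zuv' => _ _ _ h3 h4.
  by rewrite (in_slab_inj s0 h1 h3) (in_slab_inj s0 h2 h4).
have [F hF] := choice ex.
pose g z := if `[<S z>] then p0.[z] else P.[F z].
pose B := Num.max (Y - 1) (X + s).
have LB : S `|` L `<=` square 0 B.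
  move=> z [/square0E[h1 h2]|[u [v [_ /ler_normlP[u1 u2] /ler_normlP[v1 v2] /ler_normlP[h1 h2] /ler_normlP[h3 h4]]]]].
    by apply/square0E; rewrite /B !le_max h1 h2.
  by apply/square0E; rewrite /B !le_max; split; apply/orP; right; apply/ler_normlP; split; lra.
have grid K : K `<=` L -> poly_approx K g.
  move=> KL; apply: (@glue_grid K g s B) => //.
  - by move=> z /KL Lz; apply: LB; right.
  - by move=> z /KL[u [v [_ _ _ hu hv]]]; exists u, v.
  move=> u v; apply: (@poly_approx_eq _ _ (fun z => (P \Po ('X - (lattice_pt s u v)%:P)).[z])).
    exact: poly_approx_horner.
  move=> z [/KL Lz hu hv]; rewrite horner_comp hornerXsubC /g asboolF; last exact: LS.
  have [u' [v' zuv]] := Lz; rewrite (hF _ _ _ zuv); case: zuv => _ _ _ hu' hv'.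
  by rewrite (in_slab_inj s0 hu hu') (in_slab_inj s0 hv hv').
(* Both [Y] and [- Y] are odd multiples of [s], so no slab comes within 1 of them. *)
have cut u x : in_slab s u x -> [/\ x <= Y - 1 \/ Y + 1 <= x & x <= - Y - 1 \/ - Y + 1 <= x].
  move=> xu; have [h1 h2] := in_slab_cut m%:Z s0 xu.
  have [h3 h4] := in_slab_cut (- m%:Z - 1) s0 xu.
  move: h3 h4; rewrite rmorphB rmorphN /=.
  have -> : (2 * (- m%:R - 1) + 1) * s = - Y by rewrite /Y; ring.
  move=> h3 h4; split.
    by case: (leP u m%:Z) => um; [left; exact: h1|right; exact: h2].
  by case: (leP u (- m%:Z - 1)) => um; [left; exact: h3|right; exact: h4].
have cutE z : (S `|` L) z ->
  [/\ Re z <= Y - 1 \/ Y + 1 <= Re z, Re z <= - Y - 1 \/ - Y + 1 <= Re z,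
      Im z <= Y - 1 \/ Y + 1 <= Im z & Im z <= - Y - 1 \/ - Y + 1 <= Im z].
  move=> [/square0E[/ler_normlP[h1 h2] /ler_normlP[h3 h4]]|[u [v [_ _ _ hu hv]]]].
    by split; [left|right|left|right]; lra.
  by have [? ?] := cut _ _ hu; have [? ?] := cut _ _ hv; split.
(* Four cuts along the sides of the old square: each discarded part contains only cells and falls
   under [grid]; what survives all four is inside [S]. *)
have gE : poly_approx (S `|` L) g.
  apply: (@glue_Re _ _ _ B (Y - 1) (Y + 1)) => //; first lra.
  - by move=> z /cutE[].
  2: apply: grid => z [[/square0E[/ler_normlP[h1 h2] _]|//] hz]; lra.
  apply: (@glue_Re _ _ _ B (- Y - 1) (- Y + 1)); last 1 first.
  2: by move=> z [/LB].
  2: lra.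
  2: by move=> z [/cutE[]].
  2: apply: grid => z [[[/square0E[/ler_normlP[h1 h2] _]|//] hz] hz']; lra.
  apply: (@glue_Im _ _ _ B (Y - 1) (Y + 1)).
  - by move=> z [[/LB]].
  - lra.
  - by move=> z [[/cutE[]]].
  2: apply: grid => z [[[[/square0E[_ /ler_normlP[h1 h2]]|//] hz] hz'] hz'']; lra.
  apply: (@glue_Im _ _ _ B (- Y - 1) (- Y + 1)).
  - by move=> z [[[/LB]]].
  - lra.
  - by move=> z [[[/cutE[]]]].
  - apply: grid => z [[[[[/square0E[_ /ler_normlP[h1 h2]]|//] hz] hz'] hz''] h]; lra.
  apply: (@poly_approx_eq _ _ (fun z => p0.[z])); first exact: poly_approx_horner.
  move=> z [[[[_ h1] h2] h3] h4]; rewrite /g asboolT//.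
  by apply/square0E; split; apply/ler_normlP; split; lra.
have [p hp] := gE _ e0; exists p; split.
  move=> z Sz; have := hp z (or_introl Sz); rewrite /g asboolT// cabs_distC.
  by [].
move=> u v fuv hu hv z /square_lattice[zu zv].
have zuv : cell u v z by split.
have Lz : L z by exists u, v.
have := hp z (or_intror Lz); rewrite /g asboolF; last exact: LS.
by rewrite (hF _ _ _ zuv) cabs_distC.
Qed.

End GridGluing.

(** * Cauchy estimates and locally uniform limits of polynomials *)

Section PolynomialLimits.
Context {R : realType}.
Local Notation C := R[i].
Implicit Types (f g : C -> C) (p : {poly C}).

Lemma cabs_sqrt_circle (w : C) (r : R) : 0 <= r -> cabs w = r ^+ 2 ->
  exists2 z : C, z ^+ 2 = w & cabs z = r.
Proof.
move=> r0 wr; exists (sqrtc w); first exact: sqr_sqrtc.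
apply/eqP; rewrite -(eqrXn2 (n := 2)) ?cabs_ge0//.
by rewrite -cabsX sqr_sqrtc wr.
Qed.

(* Cauchy's estimate: splitting a polynomial into its even and odd parts
   replaces the circle of radius [r] by that of radius [r ^+ 2]. *)
Lemma poly_cauchy_estimate p (r e : R) k : 0 < r -> 
  (forall z, cabs z = r -> cabs p.[z] <= e) -> cabs p`_k <= e / r ^+ k.
Proof.
move=> r0.
have [n] := ubnP (size p); elim: n => // n IHn in p r e k r0 * => sp hp.
have e0 : 0 <= e.
  by apply: le_trans (hp r%:C _); rewrite ?cabs_ge0// cabs_real gtr0_norm.
(* Constants are treated apart: passing to the even part would not shrink them. *)
have [s1|s1] := leqP (size p) 1.
  case: k => [|k]; last first.
    rewrite (nth_default _ (leq_trans s1 _))// cabs0 divr_ge0// exprn_ge0//.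
    exact: ltW.
  have := hp r%:C; rewrite (size1_polyC s1) hornerC coefC eqxx expr0 divr1.
  by apply; rewrite cabs_real gtr0_norm.
have hw (w : C) : cabs w = r ^+ 2 ->
    cabs (even_poly p).[w] <= e /\ cabs (odd_poly p).[w] <= e / r.
  move=> /(cabs_sqrt_circle (ltW r0))[z zw zr].
  have h1 := hp _ zr; have h2 := hp (- z) _; rewrite cabsN in h2.
  have {}h2 := h2 zr.
  have pE x : p.[x] = (even_poly p).[x ^+ 2] + (odd_poly p).[x ^+ 2] * x.
    by rewrite -{1}(poly_even_odd p) hornerD hornerMX !horner_comp hornerXn.
  move: h1 h2; rewrite !pE sqrrN zw.
  set a := (even_poly p).[w]; set b := (odd_poly p).[w] => h1 h2.
  have c2 : cabs 2 = 2 :> R by rewrite -(rmorph_nat (@real_complex_def R (Phant R))) cabs_real ger0_norm.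
  split.
    have : cabs (a *+ 2) <= e + e.
      rewrite (_ : a *+ 2 = (a + b * z) + (a + b * - z)); last by ring.
      by apply: le_trans (cabsD _ _) _; exact: lerD.
    by rewrite -mulr_natr cabsM c2; lra.
  have : cabs (b * z *+ 2) <= e + e.
    rewrite (_ : b * z *+ 2 = (a + b * z) - (a + b * - z)); last by ring.
    by apply: le_trans (cabsB _ _) _; exact: lerD.
  by rewrite -mulr_natr !cabsM c2 zr ler_pdivlMr//; lra.
have r2 : 0 < r ^+ 2 by rewrite exprn_gt0.
have sE : (size (even_poly p) < n)%N.
  by apply: leq_ltn_trans (size_even_poly p) _; lia.
have sO : (size (odd_poly p) < n)%N.
  by apply: leq_ltn_trans (size_odd_poly p) _; lia.
have kE := odd_double_half k; rewrite -kE.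
have [ok|ok] := boolP (odd k).
  have := IHn _ (r ^+ 2) (e / r) k./2 r2 sO (fun w h => (hw w h).2).
  by rewrite coef_odd_poly -exprM mul2n add1n exprS invfM mulrA.
have := IHn _ (r ^+ 2) e k./2 r2 sE (fun w h => (hw w h).1).
by rewrite coef_even_poly -exprM mul2n.
Qed.

(** The derivative at [z], written as a coefficient so that the coefficient estimate applies to
    it. *)
Definition taylor1 p (z : C) : C := (p \Po ('X + z%:P))`_1.

Lemma taylor1B p q z : taylor1 (p - q) z = taylor1 p z - taylor1 q z.
Proof. by rewrite /taylor1 comp_polyB coefB. Qed.

(** On the circle of radius 2 the coefficient of degree [k] is at most [e / 2 ^+ k]; for increments
    of modulus at most 1 the terms from degree 2 on sum to at most half of the bound. *)
Lemma poly_taylor1_bound p z (e : R) :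
  (forall w, cabs (w - z) = 2 -> cabs p.[w] <= e) ->
  cabs (taylor1 p z) <= e /\
  forall w, cabs (w - z) <= 1 ->
    cabs (p.[w] - p.[z] - (w - z) * taylor1 p z) <= e * cabs (w - z) ^+ 2.
Proof.
move=> hp; pose q := p \Po ('X + z%:P).
have qE h : q.[h] = p.[h + z] by rewrite horner_comp !hornerE.
have e0 : 0 <= e.
  apply: le_trans (cabs_ge0 _) (hp (2%:C + z) _).
  by rewrite addrK cabs_real ger0_norm.
have hq k : cabs q`_k <= e / 2 ^+ k.
  apply: poly_cauchy_estimate => // h h2; rewrite qE; apply: hp.
  by rewrite addrK.
split; first by apply: le_trans (hq 1%N) _; rewrite expr1; lra.
move=> w w1; set h := w - z in w1 *.
have -> : p.[w] = q.[h] by rewrite qE subrK.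
have -> : p.[z] = q`_0 by rewrite -horner_coef0 qE add0r.
rewrite -/q -[taylor1 p z]/(q`_1).
(* Two extra terms, so that degrees 0 and 1 can be split off whatever the size of [q]. *)
rewrite (horner_coef_wide h (leq_addl 2 (size q))).
rewrite 2!big_ord_recl /= expr0 mulr1 expr1.
rewrite (_ : _ + _ - _ - _ = \sum_(i < size q) q`_(bump 0 (bump 0 i)) * h ^+ (bump 0 (bump 0 i))).
  2: by rewrite /bump/= /addn/=; ring.
rewrite (eq_bigr (fun i : 'I_(size q) => h ^+ 2 * (q`_i.+2 * h ^+ i))); last first.
  by move=> i _; rewrite /bump !leq0n !add1n !exprS expr0; ring.
rewrite -mulr_sumr cabsM cabsX mulrC ler_wpM2r ?exprn_ge0 ?cabs_ge0//.
apply: le_trans (cabs_sum _ _ _) _.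
apply: le_trans (_ : \sum_(i < size q) e / 2 ^+ i.+2 <= _).
  apply: ler_sum => i _; rewrite cabsM.
  apply: le_trans (_ : cabs q`_i.+2 * 1 <= _); last by rewrite mulr1 hq.
  by rewrite ler_wpM2l ?cabs_ge0// cabsX exprn_ile1 ?cabs_ge0.
suff -> : \sum_(i < size q) e / 2 ^+ i.+2 = e * (1 / 2 - (1 / 2) ^+ (size q).+1).
  have : 0 <= (1 / 2 : R) ^+ (size q).+1 by rewrite exprn_ge0.
  by move: (_ ^+ _) => t t0; nra.
elim: (size q) => [|m IHm]; first by rewrite big_ord0 expr1 subrr mulr0.
rewrite big_ord_recr/= IHm (_ : (2 ^+ m.+2)^-1 = (1 / 2) ^+ m.+2 :> R).
  by rewrite (exprS _ m.+1); field.
by rewrite div1r exprVn.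
Qed.

Lemma geometric_cauchy (u : nat -> C) : (forall n, cabs (u n.+1 - u n) <= 1 / 2 ^+ n) ->
  exists l, forall n, cabs (l - u n) <= 4 / 2 ^+ n.
Proof.
move=> hu; have p0 n : 0 < 2 ^+ n :> R by rewrite exprn_gt0.
have half n : 1 / 2 ^+ n.+1 = 1 / 2 ^+ n / 2 :> R.
  by rewrite exprS; field; rewrite gt_eqF.
have lim (v : nat -> R) : (forall n, `|v n.+1 - v n| <= 1 / 2 ^+ n) ->
    exists l, forall n, `|l - v n| <= 2 * (1 / 2 ^+ n).
  move=> hv.
  have [||| x hx] := @nested_intervals _ (fun n => v n - 2 * (1 / 2 ^+ n)) (fun n => 4 * (1 / 2 ^+ n)).
  - by move=> n; rewrite mulr_ge0// divr_ge0// ltW.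
  - move=> n; have /ler_normlP[] := hv n; rewrite half; lra.
  - move=> n; have /ler_normlP[] := hv n; rewrite half; lra.
  exists x => n; have := hx n.
  by move=> /andP[h1 h2]; apply/ler_normlP; split; lra.
have [|x hx] := lim (fun n => Re (u n)).
  by move=> n; apply: le_trans (hu n); rewrite -Re_oppc -Re_addc; exact: Re_cabs.
have [|y hy] := lim (fun n => Im (u n)).
  by move=> n; apply: le_trans (hu n); rewrite -Im_oppc -Im_addc; exact: Im_cabs.
exists (x +i* y) => n; apply: le_trans (cabs_ReIm _) _.
have four : 4 / 2 ^+ n = 2 * (1 / 2 ^+ n) + 2 * (1 / 2 ^+ n) :> R.
  by rewrite -mulrDl -natrD mul1r.
have h1 := hx n; have h2 := hy n.
by rewrite Re_addc Re_oppc Im_addc Im_oppc four; exact: lerD.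
Qed.

(** Differentiability of the limit comes from a quadratic Taylor remainder whose constant, [M + 2],
    is the same for all approximants. *)
Lemma limit_entire (p : nat -> {poly C}) (X : nat -> R) :
  (forall n, X n <= X n.+1) -> (forall B, exists n, B <= X n) ->
  (forall n z, square 0 (X n) z -> cabs ((p n.+1).[z] - (p n).[z]) <= 1 / 2 ^+ n) ->
  exists f : C -> C, (forall z, cdiff f z) /\
    forall n z, square 0 (X n) z -> cabs (f z - (p n).[z]) <= 4 / 2 ^+ n.
Proof.
move=> XS Xoo hp.
have Xm n k : X n <= X (n + k)%N.
  by elim: k => [|k IHk]; rewrite ?addn0// addnS; apply: le_trans IHk _.
have p0 n : 0 < 2 ^+ n :> R by rewrite exprn_gt0.
have hpm n k z : square 0 (X n) z ->
    cabs ((p (n + k).+1).[z] - (p (n + k)%N).[z]) <= 1 / 2 ^+ (n + k).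
  move=> /square0E[h1 h2]; apply: hp; apply/square0E.
  by split; [exact: le_trans h1 (Xm _ _)|exact: le_trans h2 (Xm _ _)].
(* The tail from [n] on, rescaled by [2 ^+ n], satisfies the hypothesis of [geometric_cauchy]. *)
have shift (u : nat -> C) n : (forall k, cabs (u (n + k).+1 - u (n + k)%N) <= 1 / 2 ^+ (n + k)) ->
    exists l, forall m, (n <= m)%N -> cabs (l - u m) <= 4 / 2 ^+ m.
  move=> hu.
  have [|l hl] := @geometric_cauchy (fun k => u (n + k)%N * (2 ^+ n)%:C).
    move=> k; rewrite -mulrBl addnS cabsM cabs_real gtr0_norm//.
    have := hu k; rewrite exprD.
    rewrite (_ : 1 / (2 ^+ n * 2 ^+ k) = 1 / 2 ^+ k / 2 ^+ n); last by field; rewrite !gt_eqF.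
    by rewrite ler_pdivlMr.
  exists (l / (2 ^+ n)%:C) => m nm; have := hl (m - n)%N; rewrite subnKC//.
  have n0 : (2 ^+ n)%:C != 0 :> C by rewrite -cabs_gt0 cabs_real gtr0_norm.
  rewrite (_ : l - _ = (l / (2 ^+ n)%:C - u m) * (2 ^+ n)%:C); last by field.
  rewrite cabsM cabs_real gtr0_norm// -ler_pdivlMr// => h; apply: le_trans h _.
  by rewrite -mulrA -invfM -exprD subnK.
have exf z : exists l, forall n, square 0 (X n) z -> cabs (l - (p n).[z]) <= 4 / 2 ^+ n.
  have [N hN] := Xoo (`|Re z| + `|Im z|).
  have zN : square 0 (X N) z by apply/square0E; split; apply: le_trans hN; rewrite ?lerDl ?lerDr.
  (* The limit is built from the least admissible index, so the estimate covers all admissible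
     ones. *)
  have [n hn hmin] := ex_minnP (ex_intro (fun n => `[<square 0 (X n) z>]) N (asboolT zN)).
  have [l hl] := shift (fun m => (p m).[z]) n (fun k => hpm n k z (asboolW hn)).
  by exists l => m zm; apply: hl; apply: hmin; exact: asboolT.
have [f hf] := choice exf.
exists f; split=> [z|n z]; last exact: hf.
(* The margin 2 puts the circle used by [poly_taylor1_bound] inside the square. *)
have [n hn] := Xoo (`|Re z| + `|Im z| + 2).
have near (w : C) : cabs (w - z) <= 2 -> square 0 (X n) w.
  move=> wz; have h1 := Re_cabs (w - z); have h2 := Im_cabs (w - z).
  rewrite !reim in h1 h2; apply/square0E.
  have h3 := ler_normD (Re w - Re z) (Re z); have h4 := ler_normD (Im w - Im z) (Im z).
  rewrite !subrK in h3 h4; have := normr_ge0 (Re z); have := normr_ge0 (Im z).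
  by split; lra.
have dq k : cabs (taylor1 (p (n + k).+1 - p (n + k)%N) z) <= 1 / 2 ^+ (n + k) /\
    forall w, cabs (w - z) <= 1 ->
    cabs ((p (n + k).+1 - p (n + k)%N).[w] - (p (n + k).+1 - p (n + k)%N).[z]
      - (w - z) * taylor1 (p (n + k).+1 - p (n + k)%N) z) <= 1 / 2 ^+ (n + k) * cabs (w - z) ^+ 2.
  apply: poly_taylor1_bound => w w2; rewrite hornerD hornerN; apply: hpm.
  by apply: near; rewrite w2.
have [D hD] := shift (fun m => taylor1 (p m) z) n (fun k => ltac:(by have [+ _] := dq k; rewrite taylor1B)).
have bn : cbounded (square 0 (X n)) by apply: (@square0_bounded _ (X n)).
have [M M0 hM] := poly_bounded (p n) bn.
have [_ hn1] := @poly_taylor1_bound (p n) z M (fun w h => hM w (near w ltac:(by rewrite h))).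
have rem k w : cabs (w - z) <= 1 ->
    cabs ((p (n + k)%N).[w] - (p (n + k)%N).[z] - (w - z) * taylor1 (p (n + k)%N) z)
    <= (M + 2 * (1 - 1 / 2 ^+ k)) * cabs (w - z) ^+ 2.
  move=> w1; elim: k => [|k IHk].
    by rewrite addn0 expr0 divr1 subrr mulr0 addr0; exact: hn1.
  have [_ /(_ w w1) h] := dq k; rewrite addnS.
  have wz0 := cabs_ge0 (w - z).
  have h2 : 1 / 2 ^+ (n + k) <= 1 / 2 ^+ k :> R.
    by rewrite !div1r lef_pV2 ?posrE// ler_weXn2l ?leq_addl//; lra.
  have h3 : 1 / 2 ^+ k.+1 = 1 / 2 ^+ k / 2 :> R by rewrite exprS; field; rewrite gt_eqF.
  have h4 : 1 / 2 ^+ (n + k) * cabs (w - z) ^+ 2 <= 1 / 2 ^+ k * cabs (w - z) ^+ 2.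
    by rewrite ler_wpM2r// exprn_ge0.
  apply: le_trans (cabs_le_dist _ _) (le_trans (lerD IHk (le_trans _ h4)) _).
    move: h; rewrite !hornerD !hornerN taylor1B => h.
    by apply: le_trans _ h; rewrite le_eqVlt; apply/orP; left; apply/eqP; congr cabs; ring.
  by rewrite h3; lra.
have fw w : cabs (w - z) <= 1 ->
    cabs (f w - f z - (w - z) * D) <= (M + 2) * cabs (w - z) ^+ 2.
  move=> w1; apply/ler_addgt0Pr => e e0.
  (* Three errors of [4 / 2 ^+ (n + k)]: at [w], at [z] and on the derivative. *)
  have [k hk] := @halving_small _ 12 e e0.
  have hk' : 12 / 2 ^+ (n + k) <= e.
    apply: le_trans (ltW hk).
    by rewrite ler_pM2l// lef_pV2 ?posrE// ler_weXn2l ?leq_addl//; lra.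
  have sq u : cabs (u - z) <= 1 -> square 0 (X (n + k)%N) u.
    move=> u1; have /square0E[h1 h2] := near u ltac:(lra); apply/square0E.
    by split; [exact: le_trans h1 (Xm _ _)|exact: le_trans h2 (Xm _ _)].
  have a1 := hf w _ (sq w w1).
  have a2 := hf z _ (sq z ltac:(by rewrite subrr cabs0)).
  have a3 := hD (n + k)%N (leq_addr _ _).
  have a4 := rem k w w1.
  have wz0 := cabs_ge0 (w - z).
  have a5 : cabs ((w - z) * (D - taylor1 (p (n + k)%N) z)) <= 4 / 2 ^+ (n + k).
    rewrite cabsM; apply: le_trans a3.
    by rewrite ler_piMl ?cabs_ge0.
  have -> : f w - f z - (w - z) * D =
    (p (n + k)%N).[w] - (p (n + k)%N).[z] - (w - z) * taylor1 (p (n + k)%N) z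
    + (f w - (p (n + k)%N).[w]) - (f z - (p (n + k)%N).[z])
    - (w - z) * (D - taylor1 (p (n + k)%N) z) by ring.
  apply: le_trans (cabsB _ _) _; apply: le_trans (lerD (cabsB _ _) (lexx _)) _.
  apply: le_trans (lerD (lerD (cabsD _ _) (lexx _)) (lexx _)) _.
  have a6 : (M + 2 * (1 - 1 / 2 ^+ k)) * cabs (w - z) ^+ 2 <= (M + 2) * cabs (w - z) ^+ 2.
    rewrite ler_wpM2r ?exprn_ge0//; have : 0 <= 1 / 2 ^+ k :> R by rewrite divr_ge0// ltW.
    lra.
  have : 12 / 2 ^+ (n + k) = 3 * (4 / 2 ^+ (n + k)) :> R by rewrite mulrA -natrM.
  lra.
exists D => e e0; have M2 : 0 < M + 2 by lra.
exists (Num.min 1 (e / (M + 2))); first by rewrite lt_min ltr01 divr_gt0.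
move=> w; rewrite le_min => /andP[w1 w2]; apply: le_trans (fw w w1) _.
rewrite expr2 mulrA ler_wpM2r ?cabs_ge0//.
by rewrite mulrC -ler_pdivlMr.
Qed.

End PolynomialLimits.

(** * Open sets of entire functions tested on one square *)

Section EntireSpace.
Context {R : realType}.
Local Notation C := R[i].

Lemma compact_square (K : set C) : compact K -> exists r : R, K `<=` square 0 r.
Proof.
move=> cK.
have := (compact_near_coveringP K).1 cK nat \oo (fun n z => cabs z <= n%:R) _.
case.
  move=> z _; exists ([set w | cabs (w - z) < 1], [set n | cabs z + 1 <= n%:R]).
    split => /=.
      apply/nbhs_normP; exists 1; first by rewrite /= ltr01.
      by move=> w /=; rewrite distrC normr_cabs (ltcR _ 1).
    have [n hn] : exists n, cabs z + 1 <= n%:R.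
      by exists (Num.truncn (cabs z + 1)).+1; rewrite ltW// truncnS_gt.
    exists n => // m /= nm; apply: le_trans hn _; by rewrite ler_nat.
  move=> [w n] /= [h1 h2]; apply: le_trans (cabs_le_dist w z) _; lra.
move=> n _ /(_ n (leqnn _)) H; exists n%:R => z /H h.
apply/square0E; split; apply: le_trans h; [exact: Re_cabs|exact: Im_cabs].
Qed.

Lemma open_entire_space (U : set (@entire_space R)) : open U -> U !=set0 ->
  exists g : C -> C, [/\ (forall z, cdiff g z) & exists r e : R, 0 < e /\
    forall h : @entire_space R, (forall z, square 0 r z -> cabs (set_val h z - g z) <= e) -> U h].
Proof.
move=> [V oV <-] [g Vg]; exists (set_val g); split.
  by move=> z; apply/cdiffP; exact: (set_valP g z).
(* The filter of uniform closeness to [g] on squares converges to [g] uniformly on compact sets, so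
   it contains every open set around [g]. *)
pose F : set_system (C -> C) := [set A | exists r e : R, 0 < e /\
  forall h : C -> C, (forall z, square 0 r z -> cabs (h z - set_val g z) <= e) -> A h].
have FF : Filter F.
  split.
  - by exists 0, 1; split.
  - move=> A B [r1 [e1 [e10 h1]]] [r2 [e2 [e20 h2]]].
    exists (Num.max r1 r2), (Num.min e1 e2); split; first by rewrite lt_min e10.
    move=> h H; split; [apply: h1|apply: h2] => z /square0E[z1 z2].
      have := H z; rewrite le_min => /(_ _)/andP[|//].
      by apply/square0E; rewrite !le_max z1 z2.
    have := H z; rewrite le_min => /(_ _)/andP[|//].
    by apply/square0E; rewrite !le_max z1 z2 !orbT.
  - move=> A B AB [r [e [e0 h]]]; exists r, e; split=> // k /h; exact: AB.
have cvF : {family compact, F --> (set_val g : {family compact, C -> C})}.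
  apply/fam_cvgP => A cA W; rewrite uniform_nbhs => -[E [entE EW]].
  have [r Ar] := compact_square cA.
  have [e e0 eE] : exists2 e : R, 0 < e & forall x y : C, cabs (y - x) <= e -> E (x, y).
    move: entE; rewrite -entourage_ballE => -[d /= d0 dE].
    have dR : d = (Re d)%:C by rewrite RRe_real// gtr0_real.
    have {}d0 : 0 < Re d by rewrite -ltcR -dR.
    exists (Re d / 2); first by lra.
    move=> x y xy; apply: dE => /=; rewrite -ball_normE /= normr_cabs dR ltcR cabs_distC.
    lra.
  exists r, e; split=> // h H; apply: EW => z /Ar Az; apply: eE; exact: H.
have /cvF [r [e [e0 H]]] : nbhs (set_val g : {family compact, C -> C}) V.
  exact: open_nbhs_nbhs.
by exists r, e; split=> // h hh; exact: H.
Qed.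

End EntireSpace.

(** * A dense sequence of polynomials *)

Section Countability.
Context {R : realType}.
Local Notation C := R[i].

Lemma injective_unbounded (f : nat -> nat) (K : nat) : injective f -> exists m, (K <= f m)%N.
Proof.
move=> fI; apply: contrapT => H.
have fK m : (f m < K)%N by rewrite ltnNge; apply/negP => h; apply: H; exists m.
have := @uniq_leq_size _ (map f (iota 0 K.+1)) (iota 0 K).
rewrite map_inj_uniq// iota_uniq size_map !size_iota ltnn.
suff h : {subset map f (iota 0 K.+1) <= iota 0 K} by move=> /(_ isT h).
by move=> _ /mapP[m _ ->]; rewrite mem_iota add0n fK.
Qed.

Definition rat_complex (q : rat * rat) : C := (ratr q.1 : R)%:C + 'i * (ratr q.2 : R)%:C.

Definition rat_poly (t : seq (rat * rat)) : {poly C} := Poly (map rat_complex t).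

Lemma rat_complex_dense (c : C) (e : R) : 0 < e -> exists q, cabs (c - rat_complex q) <= e.
Proof.
move=> e0.
have dense (x : R) : exists q : rat, `|x - ratr q| <= e / 2.
  have [q] := @rat_in_itvoo R (x - e / 2) (x + e / 2) ltac:(lra).
  rewrite in_itv /= => /andP[h1 h2]; exists q; apply/ler_normlP; split; lra.
have [q1 h1] := dense (Re c); have [q2 h2] := dense (Im c).
exists (q1, q2); apply: le_trans (cabs_ReIm _) _.
have RE : Re (rat_complex (q1, q2)) = ratr q1 by rewrite !reim; ring.
have IE : Im (rat_complex (q1, q2)) = ratr q2 by rewrite !reim; ring.
by rewrite Re_addc Re_oppc Im_addc Im_oppc RE IE; lra.
Qed.

Lemma rat_poly_dense (K : set C) p (e : R) : cbounded K -> 0 < e ->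
  exists t, forall z, K z -> cabs (p.[z] - (rat_poly t).[z]) <= e.
Proof.
move=> [M hM]; elim/poly_ind: p e => [|p c IHp] e e0.
  by exists [::] => z _; rewrite /rat_poly /= subrr cabs0 ltW.
have M0 : 0 < 2 * (`|M| + 1) by have := normr_ge0 M; lra.
have e1 : 0 < e / (2 * (`|M| + 1)) by rewrite divr_gt0.
have [t ht] := IHp _ e1; have [q hq] := @rat_complex_dense c (e / 2) ltac:(lra).
exists (q :: t) => z Kz; have h := ht z Kz.
rewrite hornerMXaddC [rat_poly (q :: t)]/= horner_cons -/(rat_poly t).
rewrite (_ : _ - _ = (p.[z] - (rat_poly t).[z]) * z + (c - rat_complex q)); last by ring.
apply: le_trans (cabsD _ _) _; rewrite cabsM (splitr e) lerD//.
have zM : cabs z <= `|M| + 1 by have := hM z Kz; have := ler_norm M; lra.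
apply: le_trans (ler_pM (cabs_ge0 _) (cabs_ge0 _) h zM) _.
rewrite le_eqVlt; apply/orP; left; apply/eqP; field.
by have := normr_ge0 M; lra.
Qed.

(** The second component of the decoded pair is a dummy: it makes each rational polynomial occur at
    infinitely many indices. *)
Definition poly_enum (l : nat) : {poly C} :=
  if @unpickle (seq (rat * rat) * nat)%type l is Some (t, _) then rat_poly t else 0.

Lemma poly_enum_dense (g : C -> C) (r e : R) (K : nat) : (forall z, cdiff g z) -> 0 < e ->
  exists2 l, (K <= l)%N & forall z, square 0 r z -> cabs (g z - (poly_enum l).[z]) <= e.
Proof.
move=> dg e0.
have r0 : 0 < `|r| + 1 by have := normr_ge0 r; lra.
have rr : square 0 r `<=` square (0 : C) (`|r| + 1).
  move=> z /square0E[h1 h2]; apply/square0E; have := ler_norm r.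
  by split; lra.
have [p hp] := @cdiff_poly_approx R g _ dg r0 (e / 2) ltac:(lra).
have [t ht] := @rat_poly_dense (square 0 r) p (e / 2) (square0_bounded (fun z h => h)) ltac:(lra).
have [|m hm] := @injective_unbounded (fun m => pickle (t, m)) K.
  by move=> m1 m2 /(pcan_inj pickleK)[].
exists (pickle (t, m)) => // z rz; rewrite /poly_enum pickleK.
apply: le_trans (cabs_dist_trans p.[z] _ _) _; rewrite (splitr e) lerD ?ht//.
exact/hp/rr.
Qed.

End Countability.

(** * Returns of the multiples of [a] to a lattice *)

Section Recurrence.
Context {R : realType}.
Local Notation C := R[i].

(** [L] is the largest of the finitely many first visit times. *)
Lemma bounded_first_visits (T : finType) (c : nat -> T) :
  exists L, forall n, exists m, [/\ (m <= L)%N, (m <= n)%N & c m = c n].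
Proof.
have first (t : T) : exists m, forall n, c n = t -> (m <= n)%N /\ c m = t.
  have [[n hn]|H] := pselect (exists n, c n == t); last first.
    by exists 0%N => n cn; case: H; exists n; apply/eqP.
  have [m /eqP cm hm] := ex_minnP (ex_intro (fun n => c n == t) n hn).
  by exists m => k /eqP/hm.
have [F hF] := choice first.
exists (\max_t F t) => n; have [h1 h2] := hF (c n) n erefl.
by exists (F (c n)); split=> //; exact: leq_bigmax.
Qed.

(* If [n] and an earlier [m] fall in the same cell of the torus, then [n - m]
   returns close to the origin. *)
Lemma torus_recurrence (x y d : R) : 0 < d ->
  exists L, forall n, exists k, [/\ (k <= n)%N, (n <= k + L)%N &
    exists u v : int, `|k%:R * x - u%:~R| <= d /\ `|k%:R * y - v%:~R| <= d].
Proof.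
move=> d0.
(* Cells of side [1 / Q < d]. *)
pose Q := (Num.truncn d^-1).+1.
have hQ : d^-1 < Q%:R by exact: truncnS_gt.
have Q0 : 0 < Q%:R :> R by apply: lt_trans hQ; rewrite invr_gt0.
pose fr (t : R) : R := t - (Num.floor t)%:~R.
have fr01 t : 0 <= fr t < 1.
  by rewrite /fr subr_ge0 ltrBlDl floor_le -intrD1 floorD1_gt.
pose ce (t : R) : 'I_Q := inord (Num.truncn (Q%:R * fr t)).
have q0 t : 0 <= Q%:R * fr t by have /andP[h1 h2] := fr01 t; rewrite mulr_ge0// ltW.
have trQ t : (Num.truncn (Q%:R * fr t) < Q)%N.
  rewrite -(ltr_nat R); have /andP[h1 h2] := fr01 t.
  apply: (@le_lt_trans _ _ (Q%:R * fr t)); first by rewrite truncn_le.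
  by rewrite -[ltRHS]mulr1 ltr_pM2l.
have ceE s t : ce s = ce t -> exists u : int, `|s - t - u%:~R| <= d.
  move=> /(congr1 val); rewrite /= !inordK ?trQ//.
  move=> E; exists (Num.floor s - Num.floor t).
  rewrite rmorphB /= (_ : s - t - _ = fr s - fr t); last by rewrite /fr; ring.
  have /andP[s1 s2] := truncn_itv (q0 s).
  have /andP[t1 t2] := truncn_itv (q0 t).
  rewrite E in s1 s2.
  have dQ : 1 <= d * Q%:R by rewrite -ler_pdivrMl// mulr1 ltW.
  set w := Num.truncn _ in s1 s2 t1 t2; rewrite -(natr1 w) in s2 t2.
  by apply/ler_normlP; split; rewrite -(ler_pM2r Q0); lra.
have [L hL] := bounded_first_visits (fun n : nat => (ce (n%:R * x), ce (n%:R * y))).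
exists L => n; have [m [mL mn [Ex Ey]]] := hL n.
exists (n - m)%N; split; [exact: leq_subr|by rewrite -leq_subLR; lia|].
have [u hu] := ceE _ _ (esym Ex); have [v hv] := ceE _ _ (esym Ey).
by exists u, v; rewrite natrB// !mulrBl.
Qed.

Lemma lattice_recurrence (a : C) (s d : R) : 0 < s -> 0 < d ->
  exists L, forall n, exists k, [/\ (k <= n)%N, (n <= k + L)%N &
    exists u v : int, square (lattice_pt s u v) d (k%:R * a)].
Proof.
move=> s0 d0; have s2 : 0 < 2 * s by lra.
have [L hL] := @torus_recurrence (Re a / (2 * s)) (Im a / (2 * s)) (d / (2 * s)) (divr_gt0 d0 s2).
exists L => n; have [k [k1 k2 [u [v [hu hv]]]]] := hL n; exists k; split=> //.
exists u, v; rewrite /square /mkset Re_lattice Im_lattice.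
have kE : k%:R = (k%:R : R)%:C :> C by rewrite rmorph_nat.
rewrite kE !reim !mul0r subr0 addr0.
have key (t w : R) : `|k%:R * (t / (2 * s)) - w| <= d / (2 * s) -> `|k%:R * t - 2 * s * w| <= d.
  move=> h; have -> : k%:R * t - 2 * s * w = (k%:R * (t / (2 * s)) - w) * (2 * s).
    by field; lra.
  by rewrite normrM (gtr0_norm s2) -ler_pdivlMr.
by split; exact: key.
Qed.

End Recurrence.

(** * Rings and the universal function *)

Section Construction.
Context {R : realType}.
Local Notation C := R[i].

(* Geometric growth makes a single ring of each type enough for a positive lower
   density; the factor [j] makes the radius an odd multiple of [2 ^ v_2(j)], so
   that the boundary of the ring runs between the cells of its grid. *)
Definition ring_radius (j : nat) : R := j%:R * 3 ^+ j.

Lemma ring_radiusS j : 3 * ring_radius j + 3 <= ring_radius j.+1.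
Proof.
rewrite /ring_radius exprS -(natr1 j).
have : 1 <= (3 : R) ^+ j by rewrite exprn_ege1//; lra.
have : 0 <= j%:R :> R by [].
by move: (3 ^+ j) (j%:R) => x y; nra.
Qed.

Lemma ring_radius_ge j : j%:R <= ring_radius j.
Proof.
have : 1 <= (3 : R) ^+ j by rewrite exprn_ege1//; lra.
by rewrite /ring_radius => h; rewrite ler_peMr.
Qed.

Lemma ring_radius_ge0 j : 0 <= ring_radius j.
Proof. by apply: le_trans (ring_radius_ge j). Qed.

Lemma ring_radius_le i j : (i <= j)%N -> ring_radius i <= ring_radius j.
Proof.
move=> /subnKC <-; elim: (j - i)%N => [|k IHk]; first by rewrite addn0.
rewrite addnS; apply: le_trans IHk _.
by have := ring_radiusS (i + k); have := ring_radius_ge0 (i + k); lra.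
Qed.

Lemma ring_radius_shift j M : (0 < j)%N ->
  ring_radius (j + M) <= M.+1%:R * 3 ^+ M * ring_radius j.
Proof.
move=> j0; rewrite /ring_radius exprD.
have h : (j + M)%:R <= M.+1%:R * j%:R :> R by rewrite -natrM ler_nat; nia.
rewrite (_ : M.+1%:R * 3 ^+ M * (j%:R * 3 ^+ j) = M.+1%:R * j%:R * (3 ^+ j * 3 ^+ M)); last by ring.
by rewrite ler_wpM2r// mulr_ge0// exprn_ge0.
Qed.

Lemma ring_radius_odd j : (0 < j)%N ->
  exists m : nat, ring_radius j = (2 * m%:R + 1) * 2 ^+ logn 2 j.
Proof.
move=> j0; exists ((j * 3 ^ j) %/ 2 ^ (logn 2 j))./2.
have [q qo jE] : exists2 q, odd q & j = (q * 2 ^ logn 2 j)%N.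
  have [//|q cq jE] := @pfactor_coprime 2 j _ j0.
  by exists q => //; rewrite coprime2n in cq.
rewrite [X in (X * _ %/ _)%N]jE mulnAC mulnK ?expn_gt0//.
have o3 : odd (q * 3 ^ j) by rewrite oddM qo oddX orbT.
have := odd_double_half (q * 3 ^ j); rewrite o3 add1n -mul2n => h.
rewrite -natrM natr1 h natrM natrX /ring_radius {1}jE natrM natrX; ring.
Qed.

(* The ring between the squares of radii [ring_radius j] and [ring_radius j.+1]
   carries copies of the polynomial of index [logn 2 j], centred at the points
   of a square lattice. *)
Definition universal (f : C -> C) := forall (j : nat) (u v : int), (0 < j)%N ->
  let s : R := 2 ^+ logn 2 j in
  ring_radius j < `|2 * s * u%:~R| \/ ring_radius j < `|2 * s * v%:~R| ->
  `|2 * s * u%:~R| <= ring_radius j.+1 - s -> `|2 * s * v%:~R| <= ring_radius j.+1 - s ->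
  forall z, square (lattice_pt s u v) (s - 1) z ->
    cabs (f z - (poly_enum (logn 2 j)).[z - lattice_pt s u v]) <= 6 / 2 ^+ j.

Lemma universal_entire : exists f : C -> C, (forall z, cdiff f z) /\ universal f.
Proof.
pose s j : R := 2 ^+ logn 2 j.
have s1 j : 1 <= s j by rewrite exprn_ege1//; lra.
have p0 n : 0 < 2 ^+ n :> R by rewrite exprn_gt0.
have stage (jp : nat * {poly C}) : exists p,
    (forall z, square 0 (ring_radius jp.1.+1 - 1) z ->
      cabs (p.[z] - jp.2.[z]) <= 1 / 2 ^+ jp.1) /\
    forall u v : int, ring_radius jp.1.+1 < `|2 * s jp.1.+1 * u%:~R| \/
      ring_radius jp.1.+1 < `|2 * s jp.1.+1 * v%:~R| ->
      `|2 * s jp.1.+1 * u%:~R| <= ring_radius jp.1.+2 - s jp.1.+1 ->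
      `|2 * s jp.1.+1 * v%:~R| <= ring_radius jp.1.+2 - s jp.1.+1 ->
      forall z, square (lattice_pt (s jp.1.+1) u v) (s jp.1.+1 - 1) z ->
        cabs (p.[z] - (poly_enum (logn 2 jp.1.+1)).[z - lattice_pt (s jp.1.+1) u v]) <= 1 / 2 ^+ jp.1.
  case: jp => j q /=; have [m mE] := ring_radius_odd (ltn0Sn j).
  have e0 : 0 < 1 / 2 ^+ j :> R by rewrite divr_gt0.
  have := runge_stage m (ring_radius j.+2 - s j.+1) q (poly_enum (logn 2 j.+1)) (s1 j.+1) e0.
  by rewrite /= -mE.
have [F hF] := choice stage.
pose p := fix p n := if n is k.+1 then F (k, p k) else 0 : {poly C}.
have hp n := hF (n, p n).
have [||n z|f [df hf]] := @limit_entire R p (fun n => ring_radius n.+1 - 1).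
- move=> n; have := ring_radius_le (leqnSn n.+1); lra.
- move=> B; exists (Num.truncn (B + 1)); have := ring_radius_ge (Num.truncn (B + 1)).+1.
  by have := truncnS_gt (B + 1); lra.
- by case: (hp n) => + _; exact.
exists f; split=> // -[//|n] u v _ sj far hu hv z zc.
have [_ /(_ u v far hu hv z zc) h1] := hp n.
have h2 : square 0 (ring_radius n.+2 - 1) z.
  move: zc; rewrite /square /mkset Re_lattice Im_lattice => -[/ler_normlP[x1 x2] /ler_normlP[y1 y2]].
  move/ler_normlP: hu => [u1 u2]; move/ler_normlP: hv => [v1 v2].
  by apply/square0E; split; apply/ler_normlP; split; lra.
have h3 := hf _ _ h2.
apply: le_trans (cabs_dist_trans (p n.+1).[z] _ _) _.
apply: le_trans (lerD h3 h1) _ => /=.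
(* The ring index is [n.+1]: 4 from the limit and 2 from the stage make the 6 of [universal]. *)
rewrite (_ : 1 / 2 ^+ n = 2 / 2 ^+ n.+1); last by rewrite exprS; field; rewrite gt_eqF.
by rewrite -mulrDl -natrD.
Qed.

End Construction.

(** * Counting hits and lower density *)

Section Counting.
Context {R : realType}.

Lemma card_windows (H : set nat) (W q al N : nat) :
  (forall i, (i < q)%N -> exists k, [/\ (al + i * W <= k)%N, (k < al + i.+1 * W)%N & H k]) ->
  (al + q * W <= N.+1)%N -> (q <= #|[pred n : 'I_N.+1 | (n : nat) \in H]|)%N.
Proof.
move=> HW qN.
have [|F hF] := @choice _ _ (fun i k => (i < q)%N ->
    [/\ (al + i * W <= k)%N, (k < al + i.+1 * W)%N & H k]).
  by move=> i; case: (ltnP i q) => [/HW[k hk]|iq]; [exists k|exists 0%N].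
have FN i : (i < q)%N -> (F i < N.+1)%N.
  move=> iq; have [_ h _] := hF i iq; apply: leq_trans h (leq_trans _ qN).
  by rewrite leq_add2l leq_mul2r iq orbT.
pose G (i : 'I_q) : 'I_N.+1 := Ordinal (FN i (ltn_ord i)).
have GI : injective G.
  move=> i j /(congr1 val) /= E.
  have [h1 h2 _] := hF i (ltn_ord i); have [h3 h4 _] := hF j (ltn_ord j).
  apply: val_inj => /=; apply/eqP; rewrite eqn_leq.
  have lt a b : (al + a * W < al + b.+1 * W)%N -> (a <= b)%N.
    by rewrite ltn_add2l ltn_mul2r ltnS => /andP[].
  apply/andP; split; apply: lt.
    by rewrite -E in h4; exact: leq_ltn_trans h1 h4.
  by rewrite -E in h3; exact: leq_ltn_trans h3 h2.
rewrite -[q in (q <= _)%N]card_ord -(card_codom GI); apply: subset_leq_card.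
apply/fintype.subsetP => _ /codomP[i ->]; apply/mem_set.
by have [_ _] := hF i (ltn_ord i).
Qed.

Lemma lower_density_gt0 (A : set nat) (c : R) (N0 : nat) : 0 < c ->
  (forall N, (N0 <= N)%N -> c * N%:R <= #|[pred n : 'I_N.+1 | (n : nat) \in A]|%:R) ->
  0 < lower_density R A.
Proof.
move=> c0 hc; rewrite /lower_density; set u := (fun N : nat => _).
have u0 N : 0 <= u N by rewrite divr_ge0.
(* There are [N + 1] indices up to [N]; at [N = 0] the quotient is 0, since the inverse of 0 is
   0. *)
have u2 N : u N <= 2.
  rewrite /u; case: N => [|N]; first by rewrite invr0 mulr0.
  rewrite ler_pdivrMr ?ltr0n// -natrM ler_nat.
  apply: leq_trans (max_card _) _; rewrite card_ord; lia.
have bu : bounded_fun (u : R^o^nat).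
  exists 2; split=> // x x2 n _ /=.
  by rewrite ger0_norm//; apply: le_trans (u2 n) (ltW x2).
rewrite (limn_infE bu); apply: lt_le_trans c0 _.
apply: le_trans (_ : infs (u : R^o^nat) (maxn N0 1) <= _).
  apply: lb_le_inf; first by exists (u (maxn N0 1)); exists (maxn N0 1) => //=.
  move=> _ [n /= hn <-]; move: hn; rewrite geq_max => /andP[n0 n1].
  by rewrite /u ler_pdivlMr ?ltr0n//; exact: hc.
apply: ub_le_sup; last by exists (maxn N0 1).
exact: bounded_fun_has_ubound_infs.
Qed.

End Counting.

(** * Lipschitz bound for polynomials and powers of 2 *)

Section Hits.
Context {R : realType}.
Local Notation C := R[i].

Lemma poly_lipschitz (K : set C) (p : {poly C}) : cbounded K ->
  exists2 L : R, 0 < L & forall z w, K z -> K w -> cabs (p.[z] - p.[w]) <= L * cabs (z - w).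
Proof.
move=> bK; have [B hB] := bK; elim/poly_ind: p => [|p c [L L0 hL]].
  by exists 1 => // z w _ _; rewrite !horner0 subrr cabs0 mulr_ge0 ?cabs_ge0.
have [M M0 hM] := poly_bounded p bK.
exists (M + `|B| * L); first by rewrite ltr_wpDr// mulr_ge0// ltW.
move=> z w Kz Kw; rewrite !hornerMXaddC.
rewrite (_ : _ - _ = p.[z] * (z - w) + w * (p.[z] - p.[w])); last by ring.
apply: le_trans (cabsD _ _) _; rewrite !cabsM mulrDl -mulrA lerD//.
  by rewrite ler_wpM2r ?cabs_ge0 ?hM.
rewrite ler_pM ?cabs_ge0 ?hL//.
by apply: le_trans (hB _ Kw) (ler_norm _).
Qed.

Lemma exp2_gt (x : R) : exists n, x < 2 ^+ n.
Proof.
exists (Num.truncn x).+1; apply: lt_le_trans (truncnS_gt x) _.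
by rewrite -natrX ler_nat ltnW// ltn_expl.
Qed.

End Hits.

(** * Rings of a given type *)

Section StageIndex.

(** The positive integers of 2-adic valuation [l], in increasing order. *)
Definition stage_index (l i : nat) := (2 ^ l * (2 * i + 1))%N.

Lemma logn_stage_index l i : logn 2 (stage_index l i) = l.
Proof.
rewrite lognM ?expn_gt0//; last by rewrite addn1.
by rewrite pfactorK// logn_coprime ?addn0// coprime2n mul2n addn1 /= odd_double.
Qed.

Lemma stage_index_gt l i : (i < stage_index l i)%N.
Proof.
by apply: (@leq_trans (2 * i + 1)); [lia|rewrite leq_pmull// expn_gt0].
Qed.

Lemma stage_indexS l i : (stage_index l i.+1).+1 = (stage_index l i + (2 ^ l * 2).+1)%N.
Proof.
by rewrite [RHS]addnS -mulnDr; congr (_ * _).+1; lia.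
Qed.

Lemma stage_index_le l i k : (i <= k)%N -> (stage_index l i <= stage_index l k)%N.
Proof. by move=> ik; rewrite leq_mul2l; apply/orP; right; lia. Qed.

End StageIndex.

(** * Hits have positive lower density for every [a] *)

Section CommonHits.
Context {R : realType}.
Local Notation C := R[i].

Definition sup_abs (a : C) : R := Num.max `|Re a| `|Im a|.

(** Near a centre [c] of the ring, [f (z + w)] is close to the value of [P] at [z + (w - c)], hence
    at [z]. The condition [r + 2 <= s] keeps [z + w] in the cell, and the margins 1 in the radii
    absorb the distance from [w] to [c]. *)
Lemma ring_hit (f : C -> C) (j : nat) (r e d : R) (w : C) (u v : int) :
  universal f -> (0 < j)%N -> 0 <= r -> 0 < d <= 1 / 2 ->
  let s : R := 2 ^+ logn 2 j in let P := poly_enum (logn 2 j) in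
  r + 2 <= s -> 6 / 2 ^+ j <= e ->
  (forall z t : C, square 0 r z -> cabs t <= 2 * d -> cabs (P.[z + t] - P.[z]) <= e) ->
  ring_radius j + 1 <= sup_abs w -> sup_abs w <= ring_radius j.+1 - s - 1 ->
  square (lattice_pt s u v) d w ->
  forall z, square 0 r z -> cabs (f (z + w) - P.[z]) <= 2 * e.
Proof.
move=> uf j0 r0 /andP[d0 d1] s P rs je Plip wl wu [].
rewrite Re_lattice Im_lattice => hu hv z rz.
have wR : `|Re w| <= sup_abs w by rewrite le_max lexx.
have wI : `|Im w| <= sup_abs w by rewrite le_max lexx orbT.
have near (x y : R) : `|x - y| <= d -> `|x| - 1 / 2 <= `|y| /\ `|y| <= `|x| + 1 / 2.
  move=> xy; have h1 := ler_normD (x - y) y; rewrite subrK in h1.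
  have h2 := ler_normB x (x - y); rewrite (_ : x - (x - y) = y) in h2; last by ring.
  by split; lra.
have [u1 u2] := near _ _ hu; have [v1 v2] := near _ _ hv.
have far : ring_radius j < `|2 * s * u%:~R| \/ ring_radius j < `|2 * s * v%:~R|.
  move: wl; rewrite /sup_abs le_max => /orP[] wl; [left|right]; lra.
set c := lattice_pt s u v.
have zc : square c (s - 1) (z + w).
  move/square0E: rz => [/ler_normlP[z1 z2] /ler_normlP[z3 z4]].
  move/ler_normlP: hu => [hu1 hu2]; move/ler_normlP: hv => [hv1 hv2].
  rewrite /square /mkset Re_lattice Im_lattice !Re_addc !Im_addc.
  by split; apply/ler_normlP; split; lra.
have u3 : `|2 * s * u%:~R| <= ring_radius j.+1 - s by lra.
have v3 : `|2 * s * v%:~R| <= ring_radius j.+1 - s by lra.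
have h1 := uf j u v j0 far u3 v3 _ zc.
have wc : cabs (w - c) <= 2 * d.
  apply: le_trans (cabs_ReIm _) _.
  by rewrite Re_addc Re_oppc Im_addc Im_oppc Re_lattice Im_lattice; lra.
have h2 := Plip z (w - c) rz wc; rewrite addrA in h2.
apply: le_trans (cabs_dist_trans P.[z + w - c] _ _) _.
by apply: le_trans (lerD h1 h2) _; lra.
Qed.

(** The last ring of type [l] that [N * a] has passed has inner radius comparable to the modulus of
    [N * a], and the hits inside it alone are a fixed proportion of [N]. *)
Lemma universal_hits (f g : C -> C) (a : C) (r e : R) : universal f ->
  (forall z, cdiff g z) -> a != 0 -> 0 <= r -> 0 < e ->
  exists (c : R) (N0 : nat), 0 < c /\ forall N, (N0 <= N)%N ->
    c * N%:R <= #|[pred n : 'I_N.+1 | (n : nat) \in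
      [set n : nat | forall z, square 0 r z -> cabs (f (z + n%:R * a) - g z) <= e]]|%:R.
Proof.
move=> uf dg a0 r0 e0.
have e3 : 0 < e / 3 by lra.
have [K hK] := exp2_gt (r + 2).
have [l Kl hl] := @poly_enum_dense R g r (e / 3) K dg e3.
pose s : R := 2 ^+ l; pose P := @poly_enum R l.
have rs : r + 2 <= s.
  by apply: le_trans (ltW hK) _; rewrite /s ler_weXn2l//; lra.
have s0 : 0 < s by lra.
have [Lp Lp0 hLp] := @poly_lipschitz R (square 0 (r + 1)) P (square0_bounded (fun z h => h)).
have [d [d0 d1 dL]] : exists d : R, [/\ 0 < d, d <= 1 / 2 & Lp * (2 * d) <= e / 3].
  exists (Num.min (1 / 2) (e / 3 / (Lp * 2))); split.
  - by rewrite lt_min !divr_gt0// mulr_gt0.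
  - by rewrite ge_min lexx.
  - rewrite mulrA mulrC -ler_pdivlMr ?mulr_gt0//.
    by rewrite ge_min lexx orbT.
have Plip (z t : C) : square 0 r z -> cabs t <= 2 * d -> cabs (P.[z + t] - P.[z]) <= e / 3.
  move=> /square0E[/ler_normlP[z1 z2] /ler_normlP[z3 z4]] td.
  have /ler_normlP[t1 t2] := le_trans (Re_cabs t) td.
  have /ler_normlP[t3 t4] := le_trans (Im_cabs t) td.
  apply: le_trans (hLp _ _ _ _) _.
  - by apply/square0E; rewrite Re_addc Im_addc; split; apply/ler_normlP; split; lra.
  - by apply/square0E; split; apply/ler_normlP; split; lra.
  by rewrite addrAC subrr add0r; apply: le_trans dL; rewrite ler_wpM2l// ltW.
have [L hL] := lattice_recurrence a s0 d0.
pose W := L.+1; have W0 : 0 < W%:R :> R by [].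
pose A := sup_abs a.
have A0 : 0 < A.
  rewrite /A /sup_abs lt_max !normr_gt0; apply: contraNT a0.
  rewrite negb_or !negbK => /andP[/eqP h1 /eqP h2].
  by apply/eqP; apply: complex_ext; rewrite ?h1 ?h2.
have supE (k : nat) : sup_abs (k%:R * a) = k%:R * A.
  have kE : k%:R = (k%:R : R)%:C :> C by rewrite rmorph_nat.
  rewrite /sup_abs kE !reim !mul0r subr0 addr0 !normrM (ger0_norm (ler0n _ k)).
  by rewrite -maxr_pMr.
have [J1 hJ1] := @halving_small _ 6 (e / 3) e3.
(* From ring [J] on, the error is at most [e / 3], the ring is wide enough for all margins, and its
   inner radius is at least two windows long. *)
pose J := maxn J1 (maxn (Num.truncn (s + 2 + A)).+1 (Num.truncn (2 * (A * W%:R))).+1).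
have hJ j : (J <= j)%N ->
    [/\ 6 / 2 ^+ j <= e / 3, s + 2 + A <= ring_radius j & 2 * (A * W%:R) <= ring_radius j].
  rewrite !geq_max => /and3P[j1 j2 j3]; split.
  - apply: le_trans (ltW hJ1); rewrite ler_pM2l; last lra.
    by rewrite lef_pV2 ?posrE ?exprn_gt0// ler_weXn2l//; lra.
  - apply: le_trans (ring_radius_ge j); apply: le_trans (ltW (truncnS_gt _)) _.
    by rewrite ler_nat.
  - apply: le_trans (ring_radius_ge j); apply: le_trans (ltW (truncnS_gt _)) _.
    by rewrite ler_nat.
pose jj := stage_index l.
pose M := (2 ^ l * 2).+1.
pose Cl : R := M.+1%:R * 3 ^+ M.
have Cl0 : 0 < Cl by rewrite mulr_gt0// exprn_gt0.
pose N0 := (Num.truncn (@ring_radius R (jj J.+1).+1 / A)).+1.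
exists (2 * W%:R * Cl)^-1, N0; split; first by rewrite invr_gt0 !mulr_gt0.
move=> N N0N.
have exi : exists i, (N%:R * A < @ring_radius R (jj i.+1).+1).
  exists (Num.truncn (N%:R * A)).+1; apply: lt_le_trans (truncnS_gt _) _.
  apply: le_trans (ring_radius_ge _); rewrite ler_nat.
  exact: leq_trans (leqnSn _) (leq_trans (ltnW (stage_index_gt l _)) (leqnSn _)).
(* By minimality [N * a] is past ring [jj i] but not past ring [jj i.+1]. *)
have [i hi imin] := ex_minnP exi.
have Ji : (J < i)%N.
  rewrite ltnNge; apply/negP => iJ.
  have : @ring_radius R (jj J.+1).+1 < N%:R * A.
    rewrite -ltr_pdivrMr//; apply: lt_le_trans (truncnS_gt _) _.
    by rewrite ler_nat.
  have : @ring_radius R (jj i.+1).+1 <= ring_radius (jj J.+1).+1.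
    by apply: ring_radius_le; rewrite ltnS stage_index_le.
  lra.
have NA : @ring_radius R (jj i).+1 <= N%:R * A.
  case: i {hi} imin Ji => [|i] imin Ji; first by rewrite ltn0 in Ji.
  by rewrite leNgt; apply/negP => /imin; rewrite ltnn.
set j := jj i in NA.
have Jj : (J <= j)%N := leq_trans (ltnW Ji) (ltnW (stage_index_gt l i)).
have j0 : (0 < j)%N := leq_ltn_trans (leq0n i) (stage_index_gt l i).
have [j6 jsA jAW] := hJ j Jj.
have jS := @ring_radiusS R j.
have NC : N%:R * A < Cl * ring_radius j.
  by apply: lt_le_trans hi _; rewrite /jj stage_indexS; exact: ring_radius_shift.
have Y0 := @ring_radius_ge0 R j.
have W1 : W%:R = L%:R + 1 :> R by rewrite natr1.
set Y := ring_radius j in jsA jAW jS NC Y0.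
have AW0 : 0 < A * W%:R by rewrite mulr_gt0.
(* [al] is the first multiple safely inside the ring; the [q] windows of [W] multiples then cover a
   length of about [Y], which fits since the outer radius exceeds [3 * Y]. *)
pose al := (Num.truncn ((Y + 1) / A)).+1.
pose q := Num.truncn (Y / (A * W%:R)).
have al1 : Y + 1 < al%:R * A by rewrite -ltr_pdivrMr// truncnS_gt.
have al2 : al%:R * A <= Y + 1 + A.
  rewrite /al -natr1 mulrDl mul1r lerD2r -ler_pdivlMr// truncn_le divr_ge0 ?(ltW A0)//.
  by rewrite addr_ge0.
have q1 : q%:R * (A * W%:R) <= Y by rewrite -ler_pdivlMr// truncn_le divr_ge0// ltW.
have q2 : Y < (q%:R + 1) * (A * W%:R) by rewrite -ltr_pdivrMr// natr1 truncnS_gt.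
have alq : (al + q * W)%:R * A <= @ring_radius R j.+1 - s - 1.
  by rewrite natrD natrM mulrDl -mulrA (mulrC W%:R); lra.
have alN : (al + q * W <= N.+1)%N.
  apply: leqW; rewrite -(ler_nat R) -(ler_pM2r A0); lra.
set H := [set n : nat | _].
have qH : (q <= #|[pred n : 'I_N.+1 | (n : nat) \in H]|)%N.
  apply: card_windows alN => ii iq.
  (* Returns are found at most [L] below the argument, so adding [L] places [k] in the window. *)
  have [k [k1 k2 [u [v huv]]]] := hL (al + ii * W + L)%N.
  have kal : (al + ii * W <= k)%N by rewrite -(leq_add2r L).
  have kal' : (k < al + ii.+1 * W)%N.
    by rewrite mulSn (addnC W) addnA addnS ltnS.
  exists k; split=> // z rz.
  have kq : (k <= al + q * W)%N.
    apply: leq_trans (ltnW kal') _; by rewrite leq_add2l leq_mul2r iq orbT.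
  have w1 : Y + 1 <= sup_abs (k%:R * a).
    rewrite supE; apply: le_trans (ltW al1) _; rewrite ler_pM2r// ler_nat.
    exact: leq_trans (leq_addr _ _) kal.
  have w2 : sup_abs (k%:R * a) <= @ring_radius R j.+1 - s - 1.
    by rewrite supE; apply: le_trans alq; rewrite ler_pM2r// ler_nat.
  have := @ring_hit f j r (e / 3) d (k%:R * a) u v uf j0 r0.
  rewrite /= (logn_stage_index l i : logn 2 j = l) => /(_ ltac:(by rewrite d0 d1) rs j6 Plip w1 w2 huv z rz) h.
  apply: le_trans (cabs_dist_trans P.[z] _ _) _.
  have h' : cabs (P.[z] - g z) <= e / 3 by rewrite cabs_distC; exact: hl.
  by apply: le_trans (lerD h h') _; lra.
apply: le_trans (_ : q%:R <= _); last by rewrite ler_nat.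
rewrite mulrC ler_pdivrMr; last by rewrite !mulr_gt0.
rewrite -(ler_pM2r A0); apply: le_trans (ltW NC) _.
(* As [2 * (A * W) <= Y], rounding in [q] loses at most half of [Y]. *)
rewrite (_ : _ * _ * A = Cl * (2 * (q%:R * (A * W%:R)))); last by ring.
by rewrite ler_pM2l//; lra.
Qed.

End CommonHits.

(** * Iterates of translations and conclusion *)

Section Main.
Context {R : realType}.
Local Notation C := R[i].

Lemma iter_translation (a : C) (f : @entire_space R) n z :
  set_val (iter n (translation a) f) z = set_val f (z + n%:R * a).
Proof.
elim: n z => [|n IHn] z; first by rewrite mul0r addr0.
have -> : set_val (iter n.+1 (translation a) f) z =
  set_val (iter n (translation a) f) (z + a) by [].
by rewrite IHn -addrA -(natr1 n) mulrDl mul1r (addrC a).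
Qed.

End Main.

Theorem theorem1p3 (R : realType) :
  (\bigcap_(a in [set a : R[i] | a != 0]) FHC R (@translation R a)) !=set0.
Proof.
have [f [df uf]] := @universal_entire R.
have ef : entire (f : {family compact, R[i] -> R[i]}) by move=> z; apply/cdiffP.
pose F : entire_space R := exist (fun g => g \in @entire R) f (mem_set ef).
exists F => a a0 U oU U0.
have [g [dg [r [e [e0 gU]]]]] := open_entire_space oU U0.
(* The radius [r] may be negative, so its absolute value is used; that only enlarges the square. *)
have [c [N0 [c0 hc]]] := universal_hits uf dg a0 (normr_ge0 r) e0.
apply: (lower_density_gt0 c0) => N /hc h; apply: le_trans h _.
rewrite ler_nat; apply: subset_leq_card; apply/fintype.subsetP => n.
rewrite !inE /= => H; apply: gU => z /square0E[z1 z2].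
rewrite iter_translation; apply: H; apply/square0E.
by split; [apply: le_trans z1 _|apply: le_trans z2 _]; exact: ler_norm.
Qed.
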